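(* Let $(E_6)^w=\{\alpha\in E_6\mid w\alpha=\alpha w\}$. Then there is an isomorphism of groups $$(E_6)^w\cong(SU(3)\times SU(3)\times SU(3))/\mathbb Z_3,$$ $$\mathbb Z_3=\{(E,E,E),(\omega_1E,\omega_1E,\omega_1E),(\omega_1^2E,\omega_1^2E,\omega_1^2E)\},\quad\omega_1=-\tfrac12+\tfrac{\sqrt3}2e_1.$$
   Context: $\mathbb H$ is the field of quaternions with basis $1,e_1,e_2,e_3$ ($e_1e_2=e_3$, etc.); the Cayley algebra is $\mathfrak C=\mathbb H\oplus\mathbb He_4$ with $(m+ae_4)(n+be_4)=(mn-\overline b a)+(a\overline n+bm)e_4$ and $\overline{m+ae_4}=\overline m-ae_4$. $\mathfrak J=\{X\in M(3,\mathfrak C)\mid X^*=X\}$ with $X\circ Y=\frac12(XY+YX)$, $\mathrm{tr}(X)$ the sum of diagonal entries, $(X,Y)=\mathrm{tr}(X\circ Y)$, $X\times Y=\frac12(2X\circ Y-\mathrm{tr}(X)Y-\mathrm{tr}(Y)X+(\mathrm{tr}(X)\mathrm{tr}(Y)-(X,Y))E)$, $\det X=\frac13(X,X\times X)$. $\mathfrak J^{\mathbb C}=\{X_1+iX_2\mid X_j\in\mathfrak J\}$ is the complexification (with imaginary unit $i$ distinct from $e_1$) with these operations extended complex (multi)linearly, $\tau(X_1+iX_2)=X_1-iX_2$, $\langle X,Y\rangle=(\tau X,Y)$. $E_6$ is the group of $\mathbb C$-linear isomorphisms $\alpha$ of $\mathfrak J^{\mathbb C}$ with $\det(\alpha X)=\det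 X$ and $\langle\alpha X,\alpha Y\rangle=\langle X,Y\rangle$. Let $\mathbf C=\mathbb R+\mathbb Re_1\subset\mathfrak C$ (a copy of the complex numbers with imaginary unit $e_1$) and $e_6=-e_2e_4$; every $x\in\mathfrak C$ is uniquely $x=a+m_1e_2+m_2e_4+m_3e_6$ with $a,m_i\in\mathbf C$, and $w:\mathfrak C\to\mathfrak C$, $w(a+m_1e_2+m_2e_4+m_3e_6)=a+(\omega_1m_1)e_2+(\omega_1m_2)e_4+(\omega_1m_3)e_6$, is an automorphism of $\mathfrak C$ of order 3. It acts entrywise on $\mathfrak J$ and is extended $\mathbb C$-linearly to $\mathfrak J^{\mathbb C}$, giving $w\in E_6$, $w^3=1$. $SU(3)=\{A\in M(3,\mathbf C)\mid A^*A=E,\ \det A=1\}$, $E$ the unit matrix. *)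

(* Defs.v *)
From HB Require Import structures.
From mathcomp Require Import all_boot all_order all_algebra.
From mathcomp Require Import spectral complex boolp reals.
From mathcomp Require Import ring.

Set Implicit Arguments.
Unset Strict Implicit.
Unset Printing Implicit Defensive.
Import Order.TTheory GRing.Theory Num.Theory.
Local Open Scope ring_scope.
Local Open Scope complex_scope.
Local Open Scope sesquilinear_scope.
Local Open Scope quotient_scope.

Definition group_isomorphic (G H : groupType) : Prop :=
  exists f : {multiplicative G -> H}, bijective f.

Structure normalSubgroup (G : groupType) := NormalSubgroup {
  nsub_pred :> {pred G};
  nsub_closed : group_closed nsub_pred;
  nsub_conj : forall x y : G, y \in nsub_pred -> (y ^ x)%g \in nsub_pred }.

Section QuotientGroup.
Variables (G : groupType) (N : normalSubgroup G).
Implicit Types x y z : G.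
Local Open Scope group_scope.

Let N1 : 1 \in nsub_pred N. Proof. by case: (nsub_closed N). Qed.
Let NF x y : x \in nsub_pred N -> y \in nsub_pred N -> x / y \in nsub_pred N.
Proof. by case: (nsub_closed N) => _; apply. Qed.
Let NV x : x \in nsub_pred N -> x^-1 \in nsub_pred N.
Proof. by move=> /(NF N1); rewrite mul1g. Qed.
Let NM x y : x \in nsub_pred N -> y \in nsub_pred N -> x * y \in nsub_pred N.
Proof. by move=> Nx /NV /(NF Nx); rewrite invgK. Qed.

Definition coset_rel : rel G := fun x y => x^-1 * y \in nsub_pred N.

Lemma coset_rel_refl : reflexive coset_rel.
Proof. by move=> x; rewrite /coset_rel mulVg. Qed.

Lemma coset_rel_sym : symmetric coset_rel.
Proof.
move=> x y; rewrite /coset_rel.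
by apply/idP/idP => /NV; rewrite invgM invgK.
Qed.

Lemma coset_rel_trans : transitive coset_rel.
Proof.
move=> y x z Nxy Nyz; rewrite /coset_rel.
by have := NM Nxy Nyz; rewrite -mulgA mulVKg.
Qed.

Canonical coset_equiv :=
  EquivRel coset_rel coset_rel_refl coset_rel_sym coset_rel_trans.

Definition quotient_group := {eq_quot coset_equiv}.

HB.instance Definition _ := Choice.on quotient_group.
HB.instance Definition _ := EqQuotient.on quotient_group.

Definition qmul := lift_op2 quotient_group (fun x y => x * y).
Definition qinv := lift_op1 quotient_group (fun x => x^-1).
Definition qone : quotient_group := \pi 1.

Lemma coset_repr x : x^-1 * repr (\pi_quotient_group x) \in nsub_pred N.
Proof.
suff: coset_equiv x (repr (\pi_quotient_group x)) by [].
by apply/eqmodP; rewrite reprK.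
Qed.

Lemma pi_qmul : {morph \pi_quotient_group : x y / x * y >-> qmul x y}.
Proof.
move=> x y; unlock qmul; apply/eqmodP.
rewrite /= /coset_rel; have := coset_repr x; have := coset_repr y.
set x' := repr (\pi x); set y' := repr (\pi y) => Ny Nx.
have -> : (x * y)^-1 * (x' * y') = (x^-1 * x') ^ y * (y^-1 * y').
  by rewrite invgM /conjg !mulgA mulgK.
by apply: NM => //; apply: nsub_conj.
Qed.
Canonical pi_qmul_morph := PiMorph2 pi_qmul.

Lemma pi_qinv : {morph \pi_quotient_group : x / x^-1 >-> qinv x}.
Proof.
move=> x; unlock qinv; apply/eqmodP.
rewrite /= /coset_rel invgK; have := coset_repr x.
set x' := repr (\pi x) => Nx; have := nsub_conj x^-1 (NV Nx).
by rewrite invgM !invgK /conjg invgK mulgK.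
Qed.
Canonical pi_qinv_morph := PiMorph1 pi_qinv.

Fact qmulA : associative qmul.
Proof.
elim/quotW=> x; elim/quotW=> y; elim/quotW=> z.
by rewrite -!pi_qmul mulgA.
Qed.
Fact qmul1 : left_id qone qmul.
Proof. by elim/quotW=> x; rewrite /qone -pi_qmul mul1g. Qed.
Fact qmulr1 : right_id qone qmul.
Proof. by elim/quotW=> x; rewrite /qone -pi_qmul mulg1. Qed.
Fact qmulV : left_inverse qone qinv qmul.
Proof. by elim/quotW=> x; rewrite -pi_qinv -pi_qmul mulVg. Qed.
Fact qmulrV : right_inverse qone qinv qmul.
Proof. by elim/quotW=> x; rewrite -pi_qinv -pi_qmul mulgV. Qed.

HB.instance Definition _ := isGroup.Build quotient_group
  qmulA qmul1 qmulr1 qmulV qmulrV.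

End QuotientGroup.

Section LinearAutomorphisms.
Variables (K : nzRingType) (V : lmodType K).

(* The product is composition: (f * g)%g = f \o g. *)
Record linear_aut := LinearAut {
  linear_aut_fun :> V -> V;
  linear_autP : `[< linear linear_aut_fun /\ bijective linear_aut_fun >] }.

HB.instance Definition _ := [isSub for linear_aut_fun].
HB.instance Definition _ := [Choice of linear_aut by <:].

Implicit Types f g : linear_aut.

Lemma linear_aut_linear f : linear f.
Proof. by case: f => f /= /asboolP []. Qed.

Lemma linear_aut_bij f : bijective f.
Proof. by case: f => f /= /asboolP []. Qed.

Fact id_aut_subproof : `[< linear (@id V) /\ bijective (@id V) >].
Proof. by apply/asboolP; split=> //; exists id. Qed.
Definition id_aut := LinearAut id_aut_subproof.

Fact comp_aut_subproof f g : `[< linear (f \o g) /\ bijective (f \o g) >].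
Proof.
apply/asboolP; split; last exact: bij_comp (linear_aut_bij f) (linear_aut_bij g).
by move=> a u v /=; rewrite !linear_aut_linear.
Qed.
Definition comp_aut f g := LinearAut (comp_aut_subproof f g).

Fact linear_aut_inv_ex f :
  exists h : V -> V, [/\ cancel f h, cancel h f & linear h /\ bijective h].
Proof.
have [h fK hK] := linear_aut_bij f; exists h; split=> //; split; last by exists f.
by move=> a u v; apply: (can_inj fK); rewrite linear_aut_linear !hK.
Qed.

Fact inv_aut_subproof f :
  `[< linear (sval (cid (linear_aut_inv_ex f))) /\
      bijective (sval (cid (linear_aut_inv_ex f))) >].
Proof. by case: cid => g /= [_ _ H]; apply/asboolP. Qed.
Definition inv_aut f := LinearAut (inv_aut_subproof f).

Lemma inv_autK f : cancel f (inv_aut f).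
Proof. by rewrite /inv_aut /=; case: cid => g []. Qed.

Lemma inv_autVK f : cancel (inv_aut f) f.
Proof. by rewrite /inv_aut /=; case: cid => g []. Qed.

Fact comp_autA : associative comp_aut.
Proof. by move=> f g h; apply: val_inj. Qed.
Fact comp_aut1 : left_id id_aut comp_aut.
Proof. by move=> f; apply: val_inj. Qed.
Fact comp_autr1 : right_id id_aut comp_aut.
Proof. by move=> f; apply: val_inj. Qed.
Fact comp_autV : left_inverse id_aut inv_aut comp_aut.
Proof. by move=> f; apply: val_inj; apply: funext => x; apply: inv_autK. Qed.
Fact comp_autrV : right_inverse id_aut inv_aut comp_aut.
Proof. by move=> f; apply: val_inj; apply: funext => x; apply: inv_autVK. Qed.

HB.instance Definition _ := isGroup.Build linear_aut
  comp_autA comp_aut1 comp_autr1 comp_autV comp_autrV.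

End LinearAutomorphisms.

Section Complexification.
Variables (R : rcfType) (V : lmodType R).

(* The pair (X1, X2) stands for X1 + i X2. *)
Definition complexification := (V * V)%type.

HB.instance Definition _ := GRing.Zmodule.on complexification.

Definition cplx_scale (a : R[i]) (X : complexification) : complexification :=
  (complex.Re a *: X.1 - complex.Im a *: X.2,
   complex.Re a *: X.2 + complex.Im a *: X.1).

Fact cplx_scaleA a b X : cplx_scale a (cplx_scale b X) = cplx_scale (a * b) X.
Proof.
case: a b X => [a1 a2] [b1 b2] [X1 X2]; rewrite /cplx_scale /=.
rewrite !scalerDr !scalerN !scalerA !scalerBl !scalerDl; congr pair.
  by rewrite !opprD [X in _ + X]addrC addrACA.
by rewrite [X in _ + X]addrC addrACA.
Qed.
Fact cplx_scale1 : left_id 1 cplx_scale.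
Proof.
by case=> [X1 X2]; rewrite /cplx_scale /= !scale1r !scale0r subr0 addr0.
Qed.
Fact cplx_scaleDr : right_distributive cplx_scale +%R.
Proof.
move=> [a1 a2] [X1 X2] [Y1 Y2]; congr pair; rewrite /= !scalerDr.
  by rewrite opprD addrACA.
by rewrite addrACA.
Qed.
Fact cplx_scaleDl X : {morph cplx_scale^~ X : a b / a + b}.
Proof.
case: X => [X1 X2] [a1 a2] [b1 b2]; congr pair; rewrite /= !scalerDl.
  by rewrite opprD addrACA.
by rewrite addrACA.
Qed.

HB.instance Definition _ := GRing.Zmodule_isLmodule.Build R[i] complexification
  cplx_scaleA cplx_scale1 cplx_scaleDr cplx_scaleDl.

End Complexification.

Definition cplx_lin (R : rcfType) (U V : lmodType R) (f : U -> V)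
    (X : complexification U) : complexification V := (f X.1, f X.2).

Definition cplx_bilin (R : rcfType) (U V W : lmodType R) (f : U -> V -> W)
    (X : complexification U) (Y : complexification V) : complexification W :=
  (f X.1 Y.1 - f X.2 Y.2, f X.1 Y.2 + f X.2 Y.1).

Definition cplx_form (R : rcfType) (U V : lmodType R) (f : U -> V -> R)
    (X : complexification U) (Y : complexification V) : R[i] :=
  (f X.1 Y.1 - f X.2 Y.2) +i* (f X.1 Y.2 + f X.2 Y.1).

Record quat (R : Type) := Quat { q0 : R; q1 : R; q2 : R; q3 : R }.

Definition quat_tuple (R : Type) (p : quat R) := (q0 p, q1 p, q2 p, q3 p).
Definition tuple_quat (R : Type) (t : R * R * R * R) :=
  let: (a, b, c, d) := t in Quat a b c d.
Lemma quat_tupleK (R : Type) : cancel (@quat_tuple R) (@tuple_quat R).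
Proof. by case. Qed.

HB.instance Definition _ (R : choiceType) := Choice.copy (quat R)
  (can_type (@quat_tupleK R)).

Section Quaternions.
Variable R : realType.
Implicit Types p q : quat R.

Definition addq p q := Quat (q0 p + q0 q) (q1 p + q1 q) (q2 p + q2 q) (q3 p + q3 q).
Definition oppq p := Quat (- q0 p) (- q1 p) (- q2 p) (- q3 p).
Definition scaleq (a : R) p := Quat (a * q0 p) (a * q1 p) (a * q2 p) (a * q3 p).

Fact addqA : associative addq.
Proof. by move=> p q r; rewrite /addq /= !addrA. Qed.
Fact addqC : commutative addq.
Proof. by move=> p q; congr Quat; apply: addrC. Qed.
Fact add0q : left_id (Quat 0 0 0 0) addq.
Proof. by case=> *; congr Quat; apply: add0r. Qed.
Fact addNq : left_inverse (Quat 0 0 0 0) oppq addq.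
Proof. by move=> p; congr Quat; apply: addNr. Qed.

HB.instance Definition _ := GRing.isZmodule.Build (quat R) addqA addqC add0q addNq.

Fact scaleqA a b p : scaleq a (scaleq b p) = scaleq (a * b) p.
Proof. by congr Quat; apply: mulrA. Qed.
Fact scale1q : left_id 1 scaleq.
Proof. by case=> *; congr Quat; apply: mul1r. Qed.
Fact scaleqDr : right_distributive scaleq +%R.
Proof. by move=> a p q; congr Quat; apply: mulrDr. Qed.
Fact scaleqDl p : {morph scaleq^~ p : a b / a + b}.
Proof. by move=> a b; congr Quat; apply: mulrDl. Qed.

HB.instance Definition _ := GRing.Zmodule_isLmodule.Build R (quat R)
  scaleqA scale1q scaleqDr scaleqDl.

Definition mulq p q := Quat
  (q0 p * q0 q - q1 p * q1 q - q2 p * q2 q - q3 p * q3 q)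
  (q0 p * q1 q + q1 p * q0 q + q2 p * q3 q - q3 p * q2 q)
  (q0 p * q2 q - q1 p * q3 q + q2 p * q0 q + q3 p * q1 q)
  (q0 p * q3 q + q1 p * q2 q - q2 p * q1 q + q3 p * q0 q).

Definition conjq p := Quat (q0 p) (- q1 p) (- q2 p) (- q3 p).

(* The pair (m, a) stands for m + a e4. *)
Definition cayley := (quat R * quat R)%type.

HB.instance Definition _ := GRing.Lmodule.on cayley.

Definition cay_mul (x y : cayley) : cayley :=
  (mulq x.1 y.1 - mulq (conjq y.2) x.2, mulq x.2 (conjq y.1) + mulq y.2 x.1).

Definition cay_conj (x : cayley) : cayley := (conjq x.1, - x.2).

Definition cay_real (a : R) : cayley := (Quat a 0 0 0, 0).
Definition cay_re (x : cayley) : R := q0 x.1.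

Definition e2 : cayley := (Quat 0 0 1 0, 0).
Definition e4 : cayley := (0, Quat 1 0 0 0).
Definition e6 : cayley := - cay_mul e2 e4.

(* R[i] is the subfield R + R e1 of the Cayley algebra, through [cay_C]; it is
   not the field of scalars of a complexification, although the type is the same. *)
Definition cay_C (z : R[i]) : cayley := (Quat (complex.Re z) (complex.Im z) 0 0, 0).

(* The coordinates a, m1, m2, m3 of x = a + m1 e2 + m2 e4 + m3 e6. *)
Definition cay_a (x : cayley) : R[i] := q0 x.1 +i* q1 x.1.
Definition cay_m1 (x : cayley) : R[i] := q2 x.1 +i* q3 x.1.
Definition cay_m2 (x : cayley) : R[i] := q0 x.2 +i* q1 x.2.
Definition cay_m3 (x : cayley) : R[i] := (- q2 x.2) +i* q3 x.2.

Definition cay_of_coords (a m1 m2 m3 : R[i]) : cayley :=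
  cay_C a + cay_mul (cay_C m1) e2 + cay_mul (cay_C m2) e4 + cay_mul (cay_C m3) e6.

Lemma cay_of_coordsE (a m1 m2 m3 : R[i]) : cay_of_coords a m1 m2 m3 =
  (Quat (complex.Re a) (complex.Im a) (complex.Re m1) (complex.Im m1),
   Quat (complex.Re m2) (complex.Im m2) (- complex.Re m3) (complex.Im m3)).
Proof.
by rewrite /cay_of_coords; congr pair; congr Quat; rewrite /=; ring.
Qed.

Lemma cay_coordsK (x : cayley) :
  cay_of_coords (cay_a x) (cay_m1 x) (cay_m2 x) (cay_m3 x) = x.
Proof.
by rewrite cay_of_coordsE; case: x => [[? ? ? ?] [? ? ? ?]] /=; rewrite opprK.
Qed.

Lemma cay_of_coords_inj (a m1 m2 m3 a' m1' m2' m3' : R[i]) :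
  cay_of_coords a m1 m2 m3 = cay_of_coords a' m1' m2' m3' ->
  [/\ a = a', m1 = m1', m2 = m2' & m3 = m3'].
Proof.
rewrite !cay_of_coordsE.
move: a m1 m2 m3 a' m1' m2' m3' =>
  [? ?] [? ?] [? ?] [? ?] [? ?] [? ?] [? ?] [? ?] /=.
by case=> -> -> -> -> -> -> /oppr_inj -> ->.
Qed.

Definition omega1 : R[i] := (- 2^-1) +i* (Num.sqrt 3 / 2).

Definition cay_w (x : cayley) : cayley :=
  cay_of_coords (cay_a x) (omega1 * cay_m1 x) (omega1 * cay_m2 x) (omega1 * cay_m3 x).

End Quaternions.

Section Jordan.
Variable R : realType.
Local Notation cayley := (cayley R).
Implicit Types A B : 'M[cayley]_3.

Definition cay_mulmx A B : 'M[cayley]_3 :=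
  \matrix_(i, j) \sum_k cay_mul (A i k) (B k j).

Definition cay_adjmx A : 'M[cayley]_3 := \matrix_(i, j) cay_conj (A j i).

Record jordan := Jordan {
  jordan_mx :> 'M[cayley]_3;
  jordanP : cay_adjmx jordan_mx == jordan_mx }.

HB.instance Definition _ := [isSub for jordan_mx].
HB.instance Definition _ := [Choice of jordan by <:].

Implicit Types X Y Z : jordan.

Lemma cay_conjD (x y : cayley) : cay_conj (x + y) = cay_conj x + cay_conj y.
Proof. by congr pair; [congr Quat|]; rewrite /= ?opprD. Qed.
Lemma cay_conjN (x : cayley) : cay_conj (- x) = - cay_conj x.
Proof. by congr pair; congr Quat. Qed.
Lemma cay_conj0 : cay_conj (0 : cayley) = 0.
Proof. by congr pair; [congr Quat|]; rewrite /= oppr0. Qed.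
Lemma cay_conjZ (a : R) (x : cayley) : cay_conj (a *: x) = a *: cay_conj x.
Proof. by congr pair; [congr Quat|]; rewrite /= ?mulrN ?scalerN. Qed.
Lemma cay_conjM (x y : cayley) :
  cay_conj (cay_mul x y) = cay_mul (cay_conj y) (cay_conj x).
Proof. by congr pair; congr Quat; rewrite /=; ring. Qed.
Lemma cay_conj_real (a : R) : cay_conj (cay_real a) = cay_real a.
Proof. by congr pair; [congr Quat|]; rewrite /= oppr0. Qed.

Lemma cay_adjmxM A B :
  cay_adjmx (cay_mulmx A B) = cay_mulmx (cay_adjmx B) (cay_adjmx A).
Proof.
apply/matrixP => i j; rewrite !mxE.
rewrite (big_morph _ cay_conjD cay_conj0).
by apply: eq_bigr => k _; rewrite !mxE cay_conjM.
Qed.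

Fact jordan_zmod_closed :
  zmod_closed [pred A : 'M[cayley]_3 | cay_adjmx A == A].
Proof.
split; first by apply/eqP/matrixP => i j; rewrite !mxE cay_conj0.
move=> A B; rewrite !inE => /eqP AH /eqP BH; apply/eqP/matrixP => i j.
by rewrite !mxE cay_conjD cay_conjN -[in RHS]AH -[in RHS]BH !mxE.
Qed.
HB.instance Definition _ :=
  GRing.SubChoice_isSubZmodule.Build _ _ jordan jordan_zmod_closed.

Fact jordan_scale_subproof (a : R) X :
  cay_adjmx (\matrix_(i, j) (a *: X i j)) == \matrix_(i, j) (a *: X i j).
Proof.
apply/eqP/matrixP => i j.
by rewrite !mxE cay_conjZ -[in RHS](eqP (jordanP X)) !mxE.
Qed.
Definition jordan_scale (a : R) X : jordan := Jordan (jordan_scale_subproof a X).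

Fact jordan_scaleA a b X :
  jordan_scale a (jordan_scale b X) = jordan_scale (a * b) X.
Proof. by apply/val_inj/matrixP => i j; rewrite !mxE scalerA. Qed.
Fact jordan_scale1 : left_id 1 jordan_scale.
Proof. by move=> X; apply/val_inj/matrixP => i j; rewrite !mxE scale1r. Qed.
Fact jordan_scaleDr : right_distributive jordan_scale +%R.
Proof. by move=> a X Y; apply/val_inj/matrixP => i j; rewrite !mxE scalerDr. Qed.
Fact jordan_scaleDl X : {morph jordan_scale^~ X : a b / a + b}.
Proof. by move=> a b; apply/val_inj/matrixP => i j; rewrite !mxE scalerDl. Qed.
HB.instance Definition _ := GRing.Zmodule_isLmodule.Build R jordan
  jordan_scaleA jordan_scale1 jordan_scaleDr jordan_scaleDl.

Fact jordan_anticomm_subproof X Y :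
  cay_adjmx (cay_mulmx X Y + cay_mulmx Y X) == cay_mulmx X Y + cay_mulmx Y X.
Proof.
have DH A B : cay_adjmx (A + B) = cay_adjmx A + cay_adjmx B.
  by apply/matrixP => i j; rewrite !mxE cay_conjD.
by rewrite DH !cay_adjmxM !(eqP (jordanP _)) addrC.
Qed.

Definition jordan_mul X Y : jordan :=
  (2^-1 : R) *: Jordan (jordan_anticomm_subproof X Y).

(* The diagonal entries of a Hermitian matrix are real. *)
Definition jordan_tr X : R := cay_re (\sum_i X i i).

Definition jordan_form X Y : R := jordan_tr (jordan_mul X Y).

Fact jordan_one_subproof :
  cay_adjmx (\matrix_(i, j) cay_real (i == j)%:R)
    == \matrix_(i, j) cay_real (i == j)%:R.
Proof. by apply/eqP/matrixP => i j; rewrite !mxE cay_conj_real eq_sym. Qed.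
Definition jordan_one : jordan := Jordan jordan_one_subproof.

Definition jordan_cross X Y : jordan :=
  (2^-1 : R) *: (2 *: jordan_mul X Y - jordan_tr X *: Y - jordan_tr Y *: X
                 + (jordan_tr X * jordan_tr Y - jordan_form X Y) *: jordan_one).

Lemma cay_w_conj (x : cayley) : cay_conj (cay_w x) = cay_w (cay_conj x).
Proof.
rewrite /cay_w !cay_of_coordsE.
by congr pair; congr Quat; rewrite /=; ring.
Qed.

Fact jordan_w_subproof X :
  cay_adjmx (\matrix_(i, j) cay_w (X i j)) == \matrix_(i, j) cay_w (X i j).
Proof.
apply/eqP/matrixP => i j.
by rewrite !mxE cay_w_conj -[in RHS](eqP (jordanP X)) !mxE.
Qed.
Definition jordan_w X : jordan := Jordan (jordan_w_subproof X).

End Jordan.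

Section E6.
Variable R : realType.

Definition jordanC := complexification (jordan R).

HB.instance Definition _ := GRing.Lmodule.on jordanC.

Implicit Types X Y : jordanC.

Definition formC : jordanC -> jordanC -> R[i] := cplx_form (@jordan_form R).
Definition crossC : jordanC -> jordanC -> jordanC := cplx_bilin (@jordan_cross R).
Definition detC X : R[i] := 3^-1 * formC X (crossC X X).
Definition tau X : jordanC := (X.1, - X.2).
Definition hprodC X Y : R[i] := formC (tau X) Y.
Definition wC : jordanC -> jordanC := cplx_lin (@jordan_w R).

(* [jordanC] is also an R-module as a pair: the scalars R[i] must be explicit. *)
Definition E6_pred : {pred @linear_aut R[i] jordanC} := fun alpha =>
  `[< (forall X, detC (alpha X) = detC X) /\
      (forall X Y, hprodC (alpha X) (alpha Y) = hprodC X Y) >].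

Record E6 := MkE6 { E6_aut :> @linear_aut R[i] jordanC; E6P : E6_pred E6_aut }.

HB.instance Definition _ := [isSub for E6_aut].
HB.instance Definition _ := [Choice of E6 by <:].

Fact E6_group_closed : group_closed E6_pred.
Proof.
split; first by apply/asboolP.
move=> a b /asboolP [da ha] /asboolP [db hb]; apply/asboolP.
have bK X : b ((b^-1)%g X) = X by apply: inv_autVK.
split=> [X|X Y].
  by transitivity (detC ((b^-1)%g X)); [exact: da | rewrite -db bK].
transitivity (hprodC ((b^-1)%g X) ((b^-1)%g Y)); first exact: ha.
by rewrite -hb !bK.
Qed.
HB.instance Definition _ := SubChoice_isSubGroup.Build _ _ E6 E6_group_closed.

Definition E6w_pred : {pred E6} := fun alpha => `[< wC \o alpha = alpha \o wC >].

Record E6w := MkE6w { E6w_E6 :> E6; E6wP : E6w_pred E6w_E6 }.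

HB.instance Definition _ := [isSub for E6w_E6].
HB.instance Definition _ := [Choice of E6w by <:].

Fact E6w_group_closed : group_closed E6w_pred.
Proof.
split; first by apply/asboolP.
move=> a b /asboolP wa /asboolP wb; apply/asboolP/funext => X /=.
have bK Y : b ((b^-1)%g Y) = Y by apply: inv_autVK.
have Kb Y : (b^-1)%g (b Y) = Y by apply: inv_autK.
have aw Y : wC (a Y) = a (wC Y) by rewrite -[LHS]/((wC \o a) Y) wa.
have bw Y : wC (b Y) = b (wC Y) by rewrite -[LHS]/((wC \o b) Y) wb.
suff E : wC ((b^-1)%g X) = (b^-1)%g (wC X) by exact: etrans (aw _) (congr1 a E).
by rewrite -[LHS]Kb -bw bK.
Qed.
HB.instance Definition _ := SubChoice_isSubGroup.Build _ _ E6w E6w_group_closed.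

End E6.

Section SU.
Variable R : realType.

(* R[i] plays the role of R + R e1. *)
Record SU3 := MkSU3 {
  SU3_mx :> 'M[R[i]]_3;
  SU3P : (SU3_mx ^t* *m SU3_mx == 1%:M) && (\det SU3_mx == 1) }.

HB.instance Definition _ := [isSub for SU3_mx].
HB.instance Definition _ := [Choice of SU3 by <:].

Implicit Types A B : SU3.

Lemma SU3_mulVmx A : A ^t* *m A = 1%:M.
Proof. by case: A => A /= /andP [/eqP]. Qed.
Lemma SU3_mulmxV A : A *m A ^t* = 1%:M.
Proof. exact: mulmx1C (SU3_mulVmx A). Qed.
Lemma SU3_det A : \det A = 1.
Proof. by case: A => A /= /andP [_ /eqP]. Qed.

Fact SU3_one_subproof :
  ((1%:M : 'M[R[i]]_3) ^t* *m 1%:M == 1%:M) && (\det (1%:M : 'M[R[i]]_3) == 1).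
Proof. by rewrite trmx1 map_mx1 mulmx1 det1 !eqxx. Qed.
Definition SU3_one := MkSU3 SU3_one_subproof.

Fact SU3_mul_subproof A B :
  ((A *m B) ^t* *m (A *m B) == 1%:M) && (\det (A *m B) == 1).
Proof.
rewrite trmx_mul map_mxM -mulmxA [_ *m (A *m B)]mulmxA.
by rewrite SU3_mulVmx mul1mx SU3_mulVmx det_mulmx !SU3_det mulr1 !eqxx.
Qed.
Definition SU3_mul A B := MkSU3 (SU3_mul_subproof A B).

Fact SU3_inv_subproof A :
  ((A ^t*) ^t* *m A ^t* == 1%:M) && (\det (A ^t*) == 1).
Proof.
rewrite trmxCK SU3_mulmxV eqxx /= det_map_mx det_tr SU3_det.
by apply/eqP; apply: rmorph1.
Qed.
Definition SU3_inv A := MkSU3 (SU3_inv_subproof A).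

Fact SU3_mulA : associative SU3_mul.
Proof. by move=> A B C; apply: val_inj; apply: mulmxA. Qed.
Fact SU3_mul1 : left_id SU3_one SU3_mul.
Proof. by move=> A; apply: val_inj; apply: mul1mx. Qed.
Fact SU3_mulr1 : right_id SU3_one SU3_mul.
Proof. by move=> A; apply: val_inj; apply: mulmx1. Qed.
Fact SU3_mulV : left_inverse SU3_one SU3_inv SU3_mul.
Proof. by move=> A; apply: val_inj; apply: SU3_mulVmx. Qed.
Fact SU3_mulrV : right_inverse SU3_one SU3_inv SU3_mul.
Proof. by move=> A; apply: val_inj; apply: SU3_mulmxV. Qed.

HB.instance Definition _ := isGroup.Build SU3
  SU3_mulA SU3_mul1 SU3_mulr1 SU3_mulV SU3_mulrV.

Definition Z3_pred : {pred SU3 * SU3 * SU3} := fun g =>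
  (SU3_mx g.1.1, SU3_mx g.1.2, SU3_mx g.2) \in
    [:: (1%:M, 1%:M, 1%:M);
        ((omega1 R)%:M, (omega1 R)%:M, (omega1 R)%:M);
        ((omega1 R ^+ 2)%:M, (omega1 R ^+ 2)%:M, (omega1 R ^+ 2)%:M)].

Lemma omega1_conj : Num.conj (omega1 R) = omega1 R ^+ 2.
Proof.
have s3 : Num.sqrt (3 : R) ^+ 2 = 3 by rewrite sqr_sqrtr ?ler0n.
rewrite -[LHS]/((omega1 R)^*)%C expr2; apply/eqP; rewrite eq_complex /=.
by apply/andP; split; apply/eqP; field: s3.
Qed.

Lemma omega1_cube : omega1 R ^+ 3 = 1.
Proof.
have s3 : Num.sqrt (3 : R) ^+ 2 = 3 by rewrite sqr_sqrtr ?ler0n.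
rewrite !exprS expr0 mulr1; apply/eqP; rewrite eq_complex /=.
by apply/andP; split; apply/eqP; field: s3.
Qed.

Lemma Z3_predP (g : SU3 * SU3 * SU3) :
  reflect (exists k, let a : 'M_3 := (omega1 R ^+ k)%:M in
             [/\ SU3_mx g.1.1 = a, SU3_mx g.1.2 = a & SU3_mx g.2 = a])
          (Z3_pred g).
Proof.
rewrite /Z3_pred !inE; apply: (iffP or3P).
  by case=> /eqP [-> -> ->]; [exists 0%N | exists 1%N | exists 2%N].
case=> k /= [-> -> ->].
have -> : omega1 R ^+ k = omega1 R ^+ (k %% 3).
  by rewrite {1}(divn_eq k 3) exprD mulnC exprM omega1_cube expr1n mul1r.
have : (k %% 3 < 3)%N by rewrite ltn_mod.
by case: (k %% 3)%N => [|[|[|]]] // _; rewrite ?expr0 ?expr1 eqxx;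
  [constructor 1 | constructor 2 | constructor 3].
Qed.

Fact Z3_group_closed : group_closed Z3_pred.
Proof.
split; first by apply/Z3_predP; exists 0%N; rewrite expr0.
move=> x y /Z3_predP [k [x1 x2 x3]] /Z3_predP [l [y1 y2 y3]].
apply/Z3_predP; exists (k + 2 * l)%N.
have E A B : SU3_mx A = (omega1 R ^+ k)%:M -> SU3_mx B = (omega1 R ^+ l)%:M ->
    SU3_mx (A / B)%g = (omega1 R ^+ (k + 2 * l))%:M.
  move=> hA hB; rewrite -[LHS]/(SU3_mx A *m (SU3_mx B) ^t*) hA hB.
  have wl : Num.conj (omega1 R ^+ l) = omega1 R ^+ (2 * l).
    by rewrite rmorphXn exprM -omega1_conj.
  by rewrite tr_scalar_mx map_scalar_mx [X in _ *m X%:M]wl -scalar_mxM -exprD.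
by split; apply: E.
Qed.

Fact Z3_conj (x y : SU3 * SU3 * SU3) : y \in Z3_pred -> (y ^ x)%g \in Z3_pred.
Proof.
move=> /Z3_predP [k [y1 y2 y3]]; apply/Z3_predP; exists k.
have E A B : SU3_mx B = (omega1 R ^+ k)%:M ->
    SU3_mx (B ^ A)%g = (omega1 R ^+ k)%:M.
  move=> hB; rewrite -[LHS]/((SU3_mx A) ^t* *m (SU3_mx B *m SU3_mx A)) hB.
  by rewrite -scalar_mxC mulmxA SU3_mulVmx mul1mx.
by split; apply: E.
Qed.

Definition Z3 := NormalSubgroup Z3_group_closed Z3_conj.

End SU.

(* Main.v *)
Require Import Defs.
From mathcomp Require Import all_boot all_order all_algebra reals.
From HB Require Import structures.
From mathcomp Require Import spectral complex boolp ring.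

(** Complexifying the subfield R + R e1 of the Cayley algebra splits it: u + i v
    is determined by the two complex numbers u + i v and conj u + i conj v, in
    which e1 has become i, respectively -i.  Two things follow for J^C.
    The R + R e1 parts of the entries of a Hermitian matrix form a Hermitian
    matrix, whose complexification is an arbitrary A in M(3, C).  The e2, e4, e6
    coordinates of the three off-diagonal entries form one more 3 x 3 matrix,
    whose complexification is a pair (B, D) of arbitrary matrices.  This is
    Tits' first construction, J^C = M(3, C) + M(3, C) + M(3, C), and in it
      det X    = det A + det B + det D - tr (A B D),
      <X, X'>  = tr (A^* A') + tr (B^* B') + tr (D^* D'),
      w        = 1 + omega1^2 + omega1  (scalars on the three summands);
    these are [detC_tits], [hprodC_tits] and [tits_w].  The determinant formula
    is reduced to the quadratic map X x X, whose components are adj A - B D,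
    adj D - A B and adj B - D A, and only these are checked entry by entry.

    The group SU(3)^3 acts by
      (P, Q, T) : (A, B, D) |-> (P A Q^-1, Q B T^-1, T D P^-1),
    visibly preserving all three structures.  If (P, Q, T) acts trivially, then
    P = Q = T commutes with every matrix, hence is a scalar of determinant 1,
    hence a power of omega1 ([Z3_ker]).

    Conversely let alpha in E6 commute with w ([rho_surj]).  It preserves the
    eigenspaces of w, so alpha = f + g + h.  Inserting vectors with a single
    component, each of f, g, h preserves the determinant and the Hermitian form,
    and then tr (f A  g B  h D) = tr (A B D).  As h is unitary, this reads
    f A * g B = k (A B), where k Z is the adjoint of the value of h at the
    adjoint of Z: an isotopy of the algebra M(3, C).  Such an isotopy is an
    automorphism up to unit factors, and automorphisms of a matrix algebra are
    inner ([Skolem_Noether]); so f A = P A Q^-1 and g B = Q B T^-1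
    ([matrix_isotopy]), and then h D = T D P^-1.
    Unitarity of f and g makes P^* P, Q^* Q and T^* T the same scalar, and
    invariance of det makes det P = det Q = det T.  Dividing P, Q and T by a
    cube root of that determinant puts them in SU(3)
    ([trilinear_isometries]). *)

Set Implicit Arguments.
Unset Strict Implicit.
Unset Printing Implicit Defensive.
Import Order.TTheory GRing.Theory Num.Theory.
Local Open Scope ring_scope.
Local Open Scope complex_scope.
Local Open Scope sesquilinear_scope.
Local Open Scope quotient_scope.

(** * Isotopies of matrix algebras *)

Section Isotopy.
Variables (F : fieldType) (n : nat).
Implicit Types A B P Q T : 'M[F]_n.

Lemma mulmx_delta_entry m p (A : 'M[F]_(m, n)) (B : 'M[F]_(n, p)) i j k l :
  (A *m delta_mx i j *m B) k l = A k i * B j l.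
Proof.
rewrite -mulmxA !mxE (bigD1 i) //= big1 => [|r /negPf rNi].
  rewrite addr0 !mxE (bigD1 j) //= big1 => [|r /negPf rNj].
    by rewrite !mxE !eqxx mul1r addr0.
  by rewrite !mxE rNj andbF mul0r.
by rewrite !mxE big1 ?mulr0 // => s _; rewrite !mxE rNi mul0r.
Qed.

Lemma mxtrace_delta A i j : \tr (A *m delta_mx i j) = A j i.
Proof.
rewrite /mxtrace (bigD1 j) //= big1 => [|k /negPf kNj].
  by rewrite -[_ *m _]mulmx1 mulmx_delta_entry mxE eqxx mulr1 addr0.
by rewrite -[_ *m _]mulmx1 mulmx_delta_entry mxE eq_sym kNj mulr0.
Qed.

Lemma mxtrace_eq A B : (forall X, \tr (A *m X) = \tr (B *m X)) -> A = B.
Proof. by move=> AB; apply/matrixP=> i j; rewrite -!mxtrace_delta. Qed.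

(** The kernel of P is stable under all matrices A, because P (A v) = phi A (P v);
    if it contains v != 0, it contains every vector. *)
Lemma intertwiner_unitmx (phi : 'M[F]_n -> 'M[F]_n) P :
  P != 0 -> (forall A, phi A *m P = P *m A) -> P \in unitmx.
Proof.
move=> P0 phiP; rewrite -unitmx_tr -row_free_unit; apply: inj_row_free => v vP.
apply: contraNeq P0 => /rV0Pn [i vi]; apply/eqP/matrixP => j k.
have Pv : P *m v^T = 0 by rewrite -[LHS]trmxK trmx_mul trmxK vP trmx0.
have : P *m delta_mx k i *m v^T = 0 by rewrite -phiP -mulmxA Pv mulmx0.
move/matrixP/(_ j 0); rewrite mulmx_delta_entry !mxE => Pjk0.
by apply: (mulIf vi); rewrite mul0r.
Qed.

End Isotopy.

(** The matrices E i j := phi (delta_mx i j) are matrix units again.  With a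
    vector v = e_j such that E 0 0 v != 0, the columns E k 0 v of P turn into
    each other as the standard basis does, so P intertwines phi and the
    identity. *)
Lemma Skolem_Noether (F : fieldType) n (phi : {linear 'M[F]_n -> 'M[F]_n}) :
    {morph phi : A B / A *m B} -> phi 1%:M = 1%:M ->
  exists2 P, P \in unitmx & forall A, phi A *m P = P *m A.
Proof.
case: n => [|n] in phi *.
  by exists 1%:M => [|A]; [exact: unitmx1 | apply/matrixP => - []].
move=> phiM phi1; pose E i j := phi (delta_mx i j).
have EM i j k l : E i j *m E k l = E i l *+ (j == k).
  by rewrite /E -phiM mul_delta_mx_cond raddfMn.
have [i [j E00]] : exists i, exists j, E 0 0 i j != 0.
  have /matrix0Pn [i [j Eij]] : E 0 0 != 0; last by exists i, j.
  apply: contra_neq (oner_neq0 ('M[F]_n.+1 : nzRingType)) => E0.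
  rewrite -[LHS]phi1 mx1_sum_delta raddf_sum big1 // => i _ /=.
  have -> : phi (delta_mx i i) = E i 0 *m E 0 0 *m E 0 i.
    by rewrite EM eqxx mulr1n EM eqxx mulr1n.
  by rewrite E0 mulmx0 mul0mx.
pose P : 'M[F]_n.+1 := \sum_k E k 0 *m delta_mx j (0 : 'I_n.+1) *m delta_mx 0 k.
have P0 : P != 0.
  apply: contra_neq E00 => /matrixP /(_ i 0).
  rewrite summxE mxE (bigD1 0) //= big1 => [|k k0].
    by rewrite mulmx_delta_entry mxE !eqxx mulr1 addr0.
  by rewrite mulmx_delta_entry mxE [0 == k]eq_sym (negPf k0) andbF mulr0.
have deltaP a b : E a b *m P = P *m delta_mx a b.
  rewrite mulmx_sumr mulmx_suml (bigD1 b) //= [RHS](bigD1 a) //=.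
  rewrite !big1 => [|k kNa|k kNb].
  - rewrite !addr0 !mulmxA EM eqxx mulr1n -[RHS]mulmxA.
    by rewrite mul_delta_mx_cond eqxx mulr1n.
  - by rewrite -mulmxA mul_delta_mx_cond (negPf kNa) mulmx0.
  by rewrite !mulmxA EM eq_sym (negPf kNb) !mul0mx.
have phiP A : phi A *m P = P *m A.
  clearbody P; rewrite [A]matrix_sum_delta.
  rewrite [phi _]linear_sum mulmx_suml mulmx_sumr; apply: eq_bigr => a _.
  rewrite [phi _]linear_sum mulmx_suml mulmx_sumr; apply: eq_bigr => b _.
  by rewrite linearZ /= -scalemxAl deltaP scalemxAr.
by exists P => //; apply: intertwiner_unitmx P0 phiP.
Qed.

Lemma central_mx_scalar (F : fieldType) n (S : 'M[F]_n) :
  (forall A, S *m A = A *m S) -> exists c, S = c%:M.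
Proof.
case: n S => [|n] S SA; first by exists 0; apply/matrixP => - [].
exists (S 0 0); apply/matrixP => j i.
have := congr1 (fun M : 'M_n.+1 => (M *m 1%:M) j 0) (SA (delta_mx i 0)).
rewrite mulmx_delta_entry mulmx1 -[in RHS](mul1mx (delta_mx i 0)) mulmx_delta_entry.
by rewrite !mxE eqxx mulr1 => ->; rewrite mulr_natl.
Qed.

(** With p = f 1 and q = g 1, which are units since k is onto, one has
    k A = f A q = p g A, so A |-> k A (p q)^-1 is multiplicative and unital,
    hence conjugation by some P; then Q = p^-1 P and T = (p q)^-1 P. *)
Lemma matrix_isotopy (F : fieldType) n (k : {linear 'M[F]_n -> 'M[F]_n})
    (f g : 'M[F]_n -> 'M[F]_n) :
    (forall A B, f A *m g B = k (A *m B)) -> (forall Z, exists A, k A = Z) ->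
  exists P Q T : 'M[F]_n, [/\ [/\ P \in unitmx, Q \in unitmx & T \in unitmx],
    forall A, f A *m Q = P *m A & forall B, g B *m T = Q *m B].
Proof.
move=> fgk ksurj; have [Z kZ] := ksurj 1%:M.
have kl B : f 1%:M *m g B = k B by rewrite fgk mul1mx.
have kr A : f A *m g 1%:M = k A by rewrite fgk mulmx1.
have [pU _] : f 1%:M \in unitmx /\ g Z \in unitmx by apply: mulmx1_unit; rewrite kl.
have [_ qU] : f Z \in unitmx /\ g 1%:M \in unitmx by apply: mulmx1_unit; rewrite kr.
have k1 := kl 1%:M.
move: (f 1%:M) (g 1%:M) kl kr k1 pU qU => p q kl kr k1 pU qU.
pose phi : {linear 'M[F]_n -> 'M[F]_n} := mulmxr (invmx q *m invmx p) \o k.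
have [||P PU phiP] := @Skolem_Noether F n phi.
- move=> A B /=; rewrite -fgk -[in RHS]kr -[in RHS]kl.
  by rewrite !mulmxA mulmxK // mulmxKV.
- by rewrite /= -k1 !mulmxA mulmxK // mulmxV.
exists P, (invmx p *m P), (invmx q *m invmx p *m P); split=> [|A|B].
- by rewrite !unitmx_mul !unitmx_inv pU qU PU.
- by rewrite -phiP /= -kr !mulmxA mulmxK.
by rewrite -[RHS]mulmxA -phiP /= -kl -!mulmxA mulKmx.
Qed.

(** * Isometric isotopies *)

Section Unitary.
Variables (C : numClosedFieldType).

Lemma adjmx_mul m n p (A : 'M[C]_(m, n)) (B : 'M[C]_(n, p)) :
  (A *m B) ^t* = B ^t* *m A ^t*.
Proof. by rewrite trmx_mul map_mxM. Qed.

Lemma det_adjmx n (A : 'M[C]_n) : \det (A ^t*) = Num.conj (\det A).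
Proof. by rewrite det_map_mx det_tr. Qed.

Lemma adjmx_scale m n a (A : 'M[C]_(m, n)) : (a *: A) ^t* = Num.conj a *: A ^t*.
Proof. by rewrite linearZ /= map_mxZ. Qed.

(** Unitarity of A |-> P A Q^-1 says that (P^* P) B = B (Q^* Q) for all B;
    B = 1 makes both Gram matrices equal, and then they are central. *)
Lemma isometry_gram n (f : 'M[C]_n -> 'M[C]_n) P Q :
    Q \in unitmx -> (forall A, f A *m Q = P *m A) ->
    (forall A B, \tr ((f A) ^t* *m f B) = \tr (A ^t* *m B)) ->
  exists2 c, P ^t* *m P = c%:M & Q ^t* *m Q = c%:M.
Proof.
move=> QU fPQ fiso; pose G := P ^t* *m P; pose H := Q ^t* *m Q.
have HU : H \in unitmx by rewrite unitmx_mul QU map_unitmx unitmx_tr QU.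
have GH B : G *m B = B *m H.
  suff GBH : G *m B *m invmx H = B by rewrite -[in RHS]GBH mulmxKV.
  apply: mxtrace_eq => X.
  have fE Y : f Y = P *m Y *m invmx Q by rewrite -fPQ mulmxK.
  have := fiso (X ^t*) B; rewrite trmxCK [in RHS]mxtrace_mulC => <-.
  have HV : invmx H = invmx Q *m (invmx Q) ^t*.
    rewrite -[RHS](mulmxK HU) -[LHS]mul1mx; congr (_ *m _).
    rewrite mulmxA -(mulmxA (invmx Q)).
    by rewrite -adjmx_mul mulmxV // trmx1 map_mx1 mulmx1 mulVmx.
  rewrite !fE HV !adjmx_mul trmxCK /G -!mulmxA.
  by rewrite [RHS]mxtrace_mulC -!mulmxA [RHS]mxtrace_mulC -!mulmxA.
have GH1 : G = H by rewrite -[G]mulmx1 GH mul1mx.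
have [|c cG] := @central_mx_scalar _ _ G; first by move=> A; rewrite GH GH1.
by exists c; rewrite // -/H -GH1.
Qed.

(** The scalar c is a nonnegative real whose (n + 1)-st power is |det P|^2 = 1. *)
Lemma special_unitary_of_gram n (P : 'M[C]_n.+1) c :
  P ^t* *m P = c%:M -> \det P = 1 -> P ^t* *m P = 1%:M.
Proof.
move=> PP detP.
have c0 : 0 <= c.
  have -> : c = (P ^t* *m P) 0 0 by rewrite PP mxE eqxx mulr1n.
  by rewrite mxE sumr_ge0 // => i _; rewrite !mxE mulrC mul_conjC_ge0.
have : c ^+ n.+1 = 1.
  by rewrite -det_scalar -PP det_mulmx det_adjmx detP rmorph1 mulr1.
by move/eqP; rewrite pexpr_eq1 // => /eqP <-.
Qed.

(** The trace identity determines h from f and g, because the trace form is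
    nondegenerate; it also makes (f, g) an isotopy, because an isometry h can be
    moved to the other side of the trace form. *)
Lemma trilinear_isometries n (f g : 'M[C]_n.+1 -> 'M[C]_n.+1)
    (h : {linear 'M[C]_n.+1 -> 'M[C]_n.+1}) :
    (forall Z, exists A, h A = Z) ->
    (forall X Y Z, \tr (f X *m g Y *m h Z) = \tr (X *m Y *m Z)) ->
    (forall X Y, \tr ((f X) ^t* *m f Y) = \tr (X ^t* *m Y)) ->
    (forall X Y, \tr ((g X) ^t* *m g Y) = \tr (X ^t* *m Y)) ->
    (forall X Y, \tr ((h X) ^t* *m h Y) = \tr (X ^t* *m Y)) ->
    (forall X, \det (f X) = \det X) -> (forall X, \det (g X) = \det X) ->
  exists P Q T : 'M[C]_n.+1,
    [/\ [/\ P ^t* *m P = 1%:M, Q ^t* *m Q = 1%:M & T ^t* *m T = 1%:M],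
        [/\ \det P = 1, \det Q = 1 & \det T = 1],
        forall X, f X = P *m X *m Q ^t*,
        forall X, g X = Q *m X *m T ^t* &
        forall X, h X = T *m X *m P ^t*].
Proof.
move=> hsurj fgh fiso giso hiso fdet gdet.
(* k is the inverse of the transpose of h for the trace form: the isometry h
   satisfies tr (k Z * h A) = tr (Z A). *)
pose k X := (h (X ^t*)) ^t*.
have klin : linear k.
  move=> a X Y; rewrite /k linearP /= map_mxD map_mxZ linearP linearP /=.
  by rewrite map_mxD map_mxZ /= conjCK.
pose kL : {linear 'M[C]_n.+1 -> 'M[C]_n.+1} :=
  HB.pack k (GRing.isLinear.Build _ _ _ _ k klin).
have fgk X Y : f X *m g Y = kL (X *m Y).
  apply: mxtrace_eq => Z; have [A <-] := hsurj Z.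
  by rewrite fgh hiso trmxCK.
have [Z|P [Q [T [[PU QU TU] fPQ gQT]]]] := matrix_isotopy fgk.
  by have [A hA] := hsurj (Z ^t*); exists (A ^t*); rewrite /= /k trmxCK hA trmxCK.
have hTP Z : h Z *m P = T *m Z.
  apply: (can_inj (mulKVmx TU)); rewrite mulKmx //.
  apply: mxtrace_eq => X; rewrite [RHS]mxtrace_mulC.
  have := fgh X 1%:M Z; rewrite mulmx1 => <-.
  rewrite -(mulmxK QU (f X)) fPQ -(mulmxK TU (g _)) gQT.
  rewrite mulmx1 !mulmxA mulmxKV // -!(mulmxA (P *m X)).
  by rewrite [RHS]mxtrace_mulC !mulmxA.
have [c PP QQ] := isometry_gram QU fPQ fiso.
have [c' QQ' TT] := isometry_gram TU gQT giso.
have {c' QQ' TT} TT : T ^t* *m T = c%:M by rewrite TT -QQ' QQ.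
have dPQ : \det P = \det Q.
  by have := fPQ 1%:M; rewrite mulmx1 => <-; rewrite det_mulmx fdet det1 mul1r.
have dQT : \det Q = \det T.
  by have := gQT 1%:M; rewrite mulmx1 => <-; rewrite det_mulmx gdet det1 mul1r.
have dP0 : \det P != 0 by rewrite -unitfE -unitmxE.
(* As det P = det Q = det T, one scalar a normalizes all three determinants. *)
pose a := (n.+1.-root (\det P))^-1.
have aP : a ^+ n.+1 * \det P = 1 by rewrite exprVn rootCK // mulVf.
have norm (M : 'M_n.+1) : M ^t* *m M = c%:M -> \det M = \det P ->
    \det (a *: M) = 1 /\ (a *: M) ^t* *m (a *: M) = 1%:M.
  move=> MM dM; have d1 : \det (a *: M) = 1 by rewrite detZ dM aP.
  split=> //; apply: (@special_unitary_of_gram _ _ (Num.conj a * a * c)) => //.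
  by rewrite adjmx_scale -scalemxAl -scalemxAr MM scalerA scale_scalar_mx.
have [dP' P'P'] := norm P PP erefl.
have [dQ' Q'Q'] := norm Q QQ (esym dPQ).
have [dT' T'T'] := norm T TT (esym (etrans dPQ dQT)).
exists (a *: P), (a *: Q), (a *: T).
have solve M N (F : 'M_n.+1 -> 'M_n.+1) : (a *: N) ^t* *m (a *: N) = 1%:M ->
    (forall X, F X *m N = M *m X) -> forall X, F X = a *: M *m X *m (a *: N) ^t*.
  move=> NN FMN X; rewrite -scalemxAl -FMN scalemxAr -mulmxA.
  by rewrite (mulmx1C NN) mulmx1.
by split=> //; exact: solve.
Qed.

End Unitary.

(** * Quotient by the kernel of a surjective morphism *)

(** Preimages under phi are chosen arbitrarily; the choice becomes multiplicative
    modulo N because two preimages of one element differ by an element of N. *)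
Lemma quotient_isomorphic (G K : groupType) (N : normalSubgroup G)
    (phi : {multiplicative G -> K}) :
    (forall k, exists g, phi g = k) ->
    (forall g, phi g = 1%g <-> g \in nsub_pred N) ->
  group_isomorphic K (quotient_group N).
Proof.
move=> phi_surj ker.
pose s k := sval (cid (phi_surj k)).
have sK k : phi (s k) = k by rewrite /s; case: cid.
pose proj (g : G) : quotient_group N := \pi g.
have projM : {morph proj : x y / (x * y)%g} by move=> x y; apply: pi_qmul.
have phi1 : phi 1%g = 1%g by apply/(mulgI (phi 1%g)); rewrite -gmulfM !mulg1.
have phiV x : phi (x^-1)%g = ((phi x)^-1)%g.
  by apply: (mulgI (phi x)); rewrite -gmulfM !mulgV.
have projP x y : proj x = proj y <-> phi x = phi y.
  have -> : (proj x = proj y) <-> (x^-1 * y)%g \in nsub_pred N.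
    by split=> [/eqmodP|H]; last exact/eqmodP.
  rewrite -ker gmulfM phiV; split=> [H|->]; last by rewrite mulVg.
  by apply: (mulgI (phi x)^-1%g); rewrite mulVg.
pose f k := proj (s k).
have fM : {morph f : x y / (x * y)%g}.
  by move=> x y; rewrite /f -projM; apply/projP; rewrite gmulfM !sK.
pose fL : {multiplicative K -> quotient_group N} :=
  HB.pack f (isMultiplicative.Build _ _ f fM).
exists fL; exists (fun q => phi (repr q)) => [k|q] /=.
  by rewrite -[RHS]sK; apply/projP; rewrite /proj reprK.
by rewrite -[RHS]reprK; apply/projP; rewrite sK.
Qed.

(** * Matrices of size 3 *)

Local Notation o0 := (@Ordinal 3 0 isT).
Local Notation o1 := (@Ordinal 3 1 isT).
Local Notation o2 := (@Ordinal 3 2 isT).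

Lemma sum3 (V : nmodType) (F : 'I_3 -> V) : \sum_i F i = F o0 + F o1 + F o2.
Proof.
rewrite !big_ord_recl big_ord0 addr0 addrA; congr (F _ + F _ + F _);
exact: val_inj.
Qed.

Lemma ord3P (P : 'I_3 -> Prop) : P o0 -> P o1 -> P o2 -> forall i, P i.
Proof.
move=> P0 P1 P2 [[|[|[|m]]] lt_m] //.
- by rewrite (_ : Ordinal lt_m = o0) //; apply: val_inj.
- by rewrite (_ : Ordinal lt_m = o1) //; apply: val_inj.
by rewrite (_ : Ordinal lt_m = o2) //; apply: val_inj.
Qed.

(** Cyclic successor, by cases so that it computes on the three ordinals.  The
    off-diagonal entry opposite to l is the one in row l + 1 and column l + 2;
    these are the entries x_1, x_2, x_3 of a Hermitian matrix. *)
Definition ord3S (i : 'I_3) : 'I_3 :=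
  match val i with 0 => o1 | 1 => o2 | _ => o0 end.

Lemma ord3_pairP (P : 'I_3 -> 'I_3 -> Prop) :
    (forall i, P i i) -> (forall l, P (ord3S l) (ord3S (ord3S l))) ->
    (forall i j, P i j -> P j i) ->
  forall i j, P i j.
Proof.
move=> diag cyc sym; elim/ord3P; elim/ord3P; first [exact: diag | idtac].
- exact: (cyc o2).
- exact: sym (cyc o1).
- exact: sym (cyc o2).
- exact: (cyc o0).
- exact: (cyc o1).
- exact: sym (cyc o0).
Qed.

(** Cyclic indexing absorbs the signs of the cofactors. *)
Lemma adj3E (K : comPzRingType) (A : 'M[K]_3) i j :
  (\adj A) i j = A (ord3S j) (ord3S i) * A (ord3S (ord3S j)) (ord3S (ord3S i))
               - A (ord3S j) (ord3S (ord3S i)) * A (ord3S (ord3S j)) (ord3S i).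
Proof.
have det2 (M : 'M[K]_2) : \det M = M 0 0 * M 1 1 - M 0 1 * M 1 0.
  rewrite (expand_det_row _ 0) !big_ord_recl big_ord0 /cofactor !det_mx11 !mxE /=.
  rewrite expr0 expr1 addr0 mul1r mulN1r mulrN.
  by congr (_ * M _ _ - M _ _ * M _ _); exact: val_inj.
have l0 : (lift o0 (0 : 'I_2) = o1) * (lift o0 (1 : 'I_2) = o2).
  by split; exact: val_inj.
have l1 : (lift o1 (0 : 'I_2) = o0) * (lift o1 (1 : 'I_2) = o2).
  by split; exact: val_inj.
have l2 : (lift o2 (0 : 'I_2) = o0) * (lift o2 (1 : 'I_2) = o1).
  by split; exact: val_inj.
rewrite mxE /cofactor det2 !mxE.
by elim/ord3P: i; elim/ord3P: j; rewrite ?l0 ?l1 ?l2 /ord3S /=; ring.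
Qed.

(** * Entries of Hermitian matrices over the Cayley algebra *)

Section TitsConstruction.
Variable R : realType.
Local Notation C := R[i].
Local Notation M3 := 'M[C]_3.
Local Notation model := (M3 * M3 * M3)%type.

Definition cay_m (k : 'I_3) (x : cayley R) : C :=
  match val k with 0 => cay_m1 x | 1 => cay_m2 x | _ => cay_m3 x end.

Lemma jordan_conj (X : jordan R) j k : X k j = cay_conj (X j k).
Proof. by rewrite -{1}(eqP (jordanP X)) mxE. Qed.

Lemma jordan_diag (X : jordan R) i : X i i = cay_real (cay_re (X i i)).
Proof.
have := jordan_conj X i i; case: (X i i) => [[a b c d] [p q r s]].
case=> /esym hb /esym hc /esym hd /esym hp /esym hq /esym hr /esym hs.
have N0 (u : R) : - u = u -> u = 0.
  by move/eqP; rewrite eq_sym -addr_eq0 -mulr2n mulrn_eq0 /= => /eqP.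
rewrite /cay_real /cay_re /=.
rewrite (N0 b hb) (N0 c hc) (N0 d hd) (N0 p hp) (N0 q hq) (N0 r hr) (N0 s hs).
by [].
Qed.

(** Stated as a rewriting rule that expresses all nine entries by six variables. *)
Lemma jordan_entries (X : jordan R) : exists a b c u v w,
  ((X o0 o0 = cay_real a) * (X o1 o1 = cay_real b) * (X o2 o2 = cay_real c) *
   (X o1 o2 = u) * (X o2 o0 = v) * (X o0 o1 = w) *
   (X o2 o1 = cay_conj u) * (X o0 o2 = cay_conj v) * (X o1 o0 = cay_conj w))%type.
Proof.
exists (cay_re (X o0 o0)), (cay_re (X o1 o1)), (cay_re (X o2 o2)).
exists (X o1 o2), (X o2 o0), (X o0 o1).
by rewrite -!jordan_diag -!jordan_conj.
Qed.

(** From here to [cross_entry] the operations of the Jordan algebra are written on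
    arrays of entries: substituting [jordan_entries] then leaves polynomials in the
    real coordinates. *)
Definition cay_dot (x y : cayley R) : R := cay_re (cay_mul x (cay_conj y)).

Definition mul_entry (x y : 'I_3 -> 'I_3 -> cayley R) i j : cayley R :=
  2^-1 *: ((cay_mul (x i o0) (y o0 j) + cay_mul (x i o1) (y o1 j)
            + cay_mul (x i o2) (y o2 j))
           + (cay_mul (y i o0) (x o0 j) + cay_mul (y i o1) (x o1 j)
              + cay_mul (y i o2) (x o2 j))).

Definition tr_entry (x : 'I_3 -> 'I_3 -> cayley R) : R :=
  cay_re (x o0 o0) + cay_re (x o1 o1) + cay_re (x o2 o2).

Definition form_entry (x y : 'I_3 -> 'I_3 -> cayley R) : R :=
  cay_re (x o0 o0) * cay_re (y o0 o0) + cay_re (x o1 o1) * cay_re (y o1 o1)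
  + cay_re (x o2 o2) * cay_re (y o2 o2)
  + 2 * (cay_dot (x o1 o2) (y o1 o2) + cay_dot (x o2 o0) (y o2 o0)
         + cay_dot (x o0 o1) (y o0 o1)).

Definition cross_entry (x y : 'I_3 -> 'I_3 -> cayley R) (i j : 'I_3) : cayley R :=
  2^-1 *: (2 *: mul_entry x y i j - tr_entry x *: y i j - tr_entry y *: x i j
    + (tr_entry x * tr_entry y - form_entry x y) *: cay_real (i == j)%:R).

Lemma jordan_mulE (X Y : jordan R) i j : jordan_mul X Y i j = mul_entry X Y i j.
Proof. by rewrite !mxE !sum3. Qed.

Lemma jordan_trE (X : jordan R) : jordan_tr X = tr_entry X.
Proof. by rewrite /jordan_tr sum3. Qed.

Lemma jordan_formE (X Y : jordan R) : jordan_form X Y = form_entry X Y.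
Proof.
rewrite /jordan_form jordan_trE /tr_entry !jordan_mulE.
have [a [b [c [u [v [w EX]]]]]] := jordan_entries X.
have [a' [b' [c' [u' [v' [w' EY]]]]]] := jordan_entries Y.
rewrite /form_entry /mul_entry !EX !EY /cay_dot /cay_re /=.
by field.
Qed.

Lemma jordan_crossE (X Y : jordan R) i j : jordan_cross X Y i j = cross_entry X Y i j.
Proof.
have ZE a (Z : jordan R) : (a *: Z) i j = a *: Z i j by rewrite mxE.
have DE (Z T : jordan R) : (Z + T) i j = Z i j + T i j by rewrite mxE.
have NE (Z : jordan R) : (- Z) i j = - Z i j by rewrite mxE.
rewrite /cross_entry -jordan_mulE -jordan_formE -!jordan_trE /jordan_cross.
move: (jordan_mul X Y) => Z.
by rewrite !(ZE, DE, NE) [jordan_one _ _ _]mxE.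
Qed.

Lemma crossC1E (X : jordanC R) j k : (crossC X X).1 j k =
  cross_entry X.1 X.1 j k - cross_entry X.2 X.2 j k.
Proof. by rewrite -!jordan_crossE [LHS]mxE [X in _ + X]mxE. Qed.

Lemma crossC2E (X : jordanC R) j k : (crossC X X).2 j k =
  cross_entry X.1 X.2 j k + cross_entry X.2 X.1 j k.
Proof. by rewrite -!jordan_crossE [LHS]mxE. Qed.

Lemma cayley_eqP (x y : cayley R) :
  cay_a x = cay_a y -> (forall k, cay_m k x = cay_m k y) -> x = y.
Proof.
move=> a m; rewrite -(cay_coordsK x) -(cay_coordsK y) a.
by rewrite [cay_m1 x](m o0) [cay_m2 x](m o1) [cay_m3 x](m o2).
Qed.

Lemma jordan_eqP (X Y : jordan R) :
  (forall j k, cay_a (X j k) = cay_a (Y j k)) ->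
  (forall k l, cay_m k (X (ord3S l) (ord3S (ord3S l)))
             = cay_m k (Y (ord3S l) (ord3S (ord3S l)))) -> X = Y.
Proof.
move=> a m; apply: val_inj; apply/matrixP => /= j k.
move: j k; apply: ord3_pairP => [i|l|i i' XY].
- rewrite jordan_diag [RHS]jordan_diag /cay_re.
  by rewrite -[q0 _]/(complex.Re (cay_a (X i i))) a.
- exact: cayley_eqP.
by rewrite jordan_conj XY -jordan_conj.
Qed.

(** * Tits coordinates *)

Lemma complex_eqP (z w : C) :
  complex.Re z = complex.Re w -> complex.Im z = complex.Im w -> z = w.
Proof. by case: z w => [? ?] [? ?] /= -> ->. Qed.

(** In [titsA], [titsB] and [titsC] 'i is the scalar i of the
    complexification.  Where no conjugate is taken, e1 has been identified with
    i; conjugates identify e1 with -i.  For [titsA] the second identification is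
    already present in the transposed entry, as the matrices are Hermitian. *)
Definition titsA (X : jordanC R) : 'M[C]_3 :=
  \matrix_(j, k) (cay_a (X.1 j k) + 'i%C * cay_a (X.2 j k)).
Definition titsB (X : jordanC R) : 'M[C]_3 :=
  \matrix_(l, k) (((cay_m k (X.1 (ord3S l) (ord3S (ord3S l))))^*)%C
    + 'i%C * ((cay_m k (X.2 (ord3S l) (ord3S (ord3S l))))^*)%C).
Definition titsC (X : jordanC R) : 'M[C]_3 :=
  \matrix_(k, l) (cay_m k (X.1 (ord3S l) (ord3S (ord3S l)))
    + 'i%C * cay_m k (X.2 (ord3S l) (ord3S (ord3S l)))).

Lemma titsAE X j k : titsA X j k = cay_a (X.1 j k) + 'i%C * cay_a (X.2 j k) :> C.
Proof. by rewrite mxE. Qed.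
Lemma titsBE X l k : titsB X l k =
  ((cay_m k (X.1 (ord3S l) (ord3S (ord3S l))))^*)%C
    + 'i%C * ((cay_m k (X.2 (ord3S l) (ord3S (ord3S l))))^*)%C :> C.
Proof. by rewrite mxE. Qed.
Lemma titsCE X k l : titsC X k l = cay_m k (X.1 (ord3S l) (ord3S (ord3S l)))
    + 'i%C * cay_m k (X.2 (ord3S l) (ord3S (ord3S l))) :> C.
Proof. by rewrite mxE. Qed.

Lemma cay_a_lin (p q : R) (x y z : cayley R) :
  cay_a (p *: x + q *: y + z) = p%:C * cay_a x + q%:C * cay_a y + cay_a z.
Proof. by apply: complex_eqP => /=; ring. Qed.

Lemma cay_m_lin k (p q : R) (x y z : cayley R) :
  cay_m k (p *: x + q *: y + z) = p%:C * cay_m k x + q%:C * cay_m k y + cay_m k z.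
Proof. by elim/ord3P: k; apply: complex_eqP; rewrite /cay_m /=; ring. Qed.

Lemma jordan_lin_entry (p q : R) (X Y Z : jordan R) j k :
  (p *: X + q *: Y + Z) j k = p *: X j k + q *: Y j k + Z j k.
Proof. by rewrite !mxE. Qed.

Lemma jordanC_lin (a : C) (X Y : jordanC R) : a *: X + Y =
  (complex.Re a *: X.1 + (- complex.Im a) *: X.2 + Y.1,
   complex.Re a *: X.2 + complex.Im a *: X.1 + Y.2).
Proof. by rewrite scaleNr. Qed.

Lemma titsA_linear : linear titsA.
Proof.
move=> a X Y; rewrite jordanC_lin; apply/matrixP=> j k.
rewrite [RHS]mxE [(a *: titsA X) _ _]mxE !titsAE /=.
rewrite !jordan_lin_entry !cay_a_lin.
move: (cay_a (X.1 j k)) (cay_a (X.2 j k)) (cay_a (Y.1 j k)) (cay_a (Y.2 j k)).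
by case: a => p q [? ?] [? ?] [? ?] [? ?]; apply: complex_eqP => /=; ring.
Qed.

Lemma titsB_linear : linear titsB.
Proof.
move=> a X Y; rewrite jordanC_lin; apply/matrixP=> l k.
rewrite [RHS]mxE [(a *: titsB X) _ _]mxE !titsBE /=.
rewrite !jordan_lin_entry !cay_m_lin.
move: (cay_m k (X.1 _ _)) (cay_m k (X.2 _ _)) (cay_m k (Y.1 _ _)) (cay_m k (Y.2 _ _)).
by case: a => p q [? ?] [? ?] [? ?] [? ?]; apply: complex_eqP => /=; ring.
Qed.

Lemma titsC_linear : linear titsC.
Proof.
move=> a X Y; rewrite jordanC_lin; apply/matrixP=> k l.
rewrite [RHS]mxE [(a *: titsC X) _ _]mxE !titsCE /=.
rewrite !jordan_lin_entry !cay_m_lin.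
move: (cay_m k (X.1 _ _)) (cay_m k (X.2 _ _)) (cay_m k (Y.1 _ _)) (cay_m k (Y.2 _ _)).
by case: a => p q [? ?] [? ?] [? ?] [? ?]; apply: complex_eqP => /=; ring.
Qed.

Lemma cay_a_w (x : cayley R) : cay_a (cay_w x) = cay_a x.
Proof.
have := cay_coordsK (cay_w x); rewrite {2}/cay_w.
by case/cay_of_coords_inj.
Qed.

Lemma cay_m_w k (x : cayley R) : cay_m k (cay_w x) = omega1 R * cay_m k x.
Proof.
have := cay_coordsK (cay_w x); rewrite {2}/cay_w.
by case/cay_of_coords_inj => _ m1 m2 m3; elim/ord3P: k.
Qed.

Lemma titsA_w (X : jordanC R) : titsA (wC X) = titsA X.
Proof.
by apply/matrixP=> j k; rewrite !titsAE /= ![jordan_w _ _ _]mxE !cay_a_w.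
Qed.

Lemma titsB_w (X : jordanC R) : titsB (wC X) = omega1 R ^+ 2 *: titsB X.
Proof.
apply/matrixP=> l k; rewrite [RHS]mxE !titsBE /= ![jordan_w _ _ _]mxE !cay_m_w.
rewrite -omega1_conj -[Num.conj (omega1 R)]/((omega1 R)^*)%C !rmorphM /=.
by rewrite mulrDr !mulrA ['i%C * _]mulrC.
Qed.

Lemma titsC_w (X : jordanC R) : titsC (wC X) = omega1 R *: titsC X.
Proof.
apply/matrixP=> k l; rewrite [RHS]mxE !titsCE /= ![jordan_w _ _ _]mxE !cay_m_w.
by rewrite mulrDr !mulrA ['i%C * _]mulrC.
Qed.

(** * Tits coordinates are a linear bijection *)

(** [iota_re p q] and [iota_im p q] are the solutions z and w of
    z + i w = p, conj z + i conj w = q. *)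
Definition iota_re (p q : C) : C :=
  ((complex.Re p + complex.Re q) / 2) +i* ((complex.Im p - complex.Im q) / 2).
Definition iota_im (p q : C) : C :=
  ((complex.Im p + complex.Im q) / 2) +i* ((complex.Re q - complex.Re p) / 2).

Lemma iota_reK (z w : C) : iota_re (z + 'i%C * w) ((z^*)%C + 'i%C * (w^*)%C) = z.
Proof. by case: z w => [? ?] [? ?]; apply: complex_eqP => /=; field. Qed.

Lemma iota_imK (z w : C) : iota_im (z + 'i%C * w) ((z^*)%C + 'i%C * (w^*)%C) = w.
Proof. by case: z w => [? ?] [? ?]; apply: complex_eqP => /=; field. Qed.

Lemma iotaK (p q : C) : iota_re p q + 'i%C * iota_im p q = p.
Proof. by case: p q => [? ?] [? ?]; apply: complex_eqP => /=; field. Qed.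

Lemma iotaJK (p q : C) : ((iota_re p q)^*)%C + 'i%C * ((iota_im p q)^*)%C = q.
Proof. by case: p q => [? ?] [? ?]; apply: complex_eqP => /=; field. Qed.

Definition tits (X : jordanC R) := (titsA X, titsB X, titsC X).

Lemma titsA_conj X j k : titsA X k j =
  ((cay_a (X.1 j k))^*)%C + 'i%C * ((cay_a (X.2 j k))^*)%C :> C.
Proof. by rewrite titsAE (jordan_conj X.1 j) (jordan_conj X.2 j). Qed.

Lemma cay_a_re (X : jordanC R) j k :
  cay_a (X.1 j k) = iota_re (titsA X j k) (titsA X k j).
Proof. by rewrite (titsA_conj X j k) titsAE iota_reK. Qed.

Lemma cay_a_im (X : jordanC R) j k :
  cay_a (X.2 j k) = iota_im (titsA X j k) (titsA X k j).
Proof. by rewrite (titsA_conj X j k) titsAE iota_imK. Qed.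

Lemma cay_m_re (X : jordanC R) k l :
  cay_m k (X.1 (ord3S l) (ord3S (ord3S l))) = iota_re (titsC X k l) (titsB X l k).
Proof. by rewrite titsCE titsBE iota_reK. Qed.

Lemma cay_m_im (X : jordanC R) k l :
  cay_m k (X.2 (ord3S l) (ord3S (ord3S l))) = iota_im (titsC X k l) (titsB X l k).
Proof. by rewrite titsCE titsBE iota_imK. Qed.

Lemma tits_inj : injective tits.
Proof.
move=> X Y [EA EB ED]; apply: injective_projections.
  apply: jordan_eqP => [j k|k l]; first by rewrite !cay_a_re EA.
  by rewrite !cay_m_re EB ED.
apply: jordan_eqP => [j k|k l]; first by rewrite !cay_a_im EA.
by rewrite !cay_m_im EB ED.
Qed.

Definition hermitian_mx (d : 'I_3 -> R) (x : 'I_3 -> cayley R) : 'M[cayley R]_3 :=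
  \matrix_(i, j) match val i, val j with
    | 0, 0 => cay_real (d o0) | 1, 1 => cay_real (d o1) | 2, 2 => cay_real (d o2)
    | 1, 2 => x o0 | 2, 1 => cay_conj (x o0)
    | 2, 0 => x o1 | 0, 2 => cay_conj (x o1)
    | 0, 1 => x o2 | 1, 0 => cay_conj (x o2)
    | _, _ => 0
  end.

Lemma cay_conjK (x : cayley R) : cay_conj (cay_conj x) = x.
Proof.
by case: x => [[? ? ? ?] ?]; rewrite /cay_conj /conjq /= !opprK.
Qed.

Fact hermitian_mx_subproof d x : cay_adjmx (hermitian_mx d x) == hermitian_mx d x.
Proof.
apply/eqP/matrixP => i j; rewrite !mxE.
by elim/ord3P: i; elim/ord3P: j; rewrite /= ?cay_conjK ?cay_conj_real.
Qed.
Definition jordan_of d x : jordan R := Jordan (hermitian_mx_subproof d x).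

Lemma jordan_of_cyc d x l : jordan_of d x (ord3S l) (ord3S (ord3S l)) = x l.
Proof. by elim/ord3P: l; rewrite mxE. Qed.

Lemma jordan_of_diag d x i : jordan_of d x i i = cay_real (d i).
Proof. by elim/ord3P: i; rewrite mxE. Qed.

Lemma cay_of_coords_a (a m1 m2 m3 : C) : cay_a (cay_of_coords a m1 m2 m3) = a.
Proof. by have /cay_of_coords_inj [] := cay_coordsK (cay_of_coords a m1 m2 m3). Qed.

Lemma cay_of_coords_m (a : C) (m : 'I_3 -> C) k :
  cay_m k (cay_of_coords a (m o0) (m o1) (m o2)) = m k.
Proof.
have /cay_of_coords_inj [_ m1 m2 m3] :=
  cay_coordsK (cay_of_coords a (m o0) (m o1) (m o2)).
by elim/ord3P: k.
Qed.

(** With f = [iota_re] and f = [iota_im] these are the two halves X1 and X2 of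
    the element X1 + i X2 that has Tits coordinates (A, B, D). *)
Definition tits_preim (f : C -> C -> C) (A B D : 'M[C]_3) : jordan R :=
  jordan_of (fun i => complex.Re (f (A i i) (A i i)))
    (fun l => cay_of_coords
       (f (A (ord3S l) (ord3S (ord3S l))) (A (ord3S (ord3S l)) (ord3S l)))
       (f (D o0 l) (B l o0)) (f (D o1 l) (B l o1)) (f (D o2 l) (B l o2))).

Lemma tits_preim_m f A B D k l :
  cay_m k (tits_preim f A B D (ord3S l) (ord3S (ord3S l))) = f (D k l) (B l k).
Proof.
by rewrite jordan_of_cyc (cay_of_coords_m _ (fun k => f (D k l) (B l k))).
Qed.

Lemma tits_preim_a f A B D j k :
    (forall z w, f w z = (f z w)^*)%C ->
  cay_a (tits_preim f A B D j k) = f (A j k) (A k j).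
Proof.
move=> fJ.
move: j k; apply: ord3_pairP => [i|l|i i' aE].
- rewrite jordan_of_diag; move: (fJ (A i i) (A i i)).
  (* A self-conjugate complex number has no imaginary part. *)
  case: (f _ _) => u v [] /eqP; rewrite -addr_eq0 -mulr2n mulrn_eq0 /= => /eqP ->.
  by [].
- by rewrite jordan_of_cyc cay_of_coords_a.
by rewrite fJ -aE jordan_conj.
Qed.

Lemma tits_surj A B D : exists X, tits X = (A, B, D).
Proof.
exists (tits_preim iota_re A B D, tits_preim iota_im A B D); congr (_, _, _).
- apply/matrixP=> j k; rewrite titsAE !tits_preim_a ?iotaK // => - [? ?] [? ?];
  by apply: complex_eqP => /=; ring.
- by apply/matrixP=> l k; rewrite titsBE !tits_preim_m iotaJK.
by apply/matrixP=> k l; rewrite titsCE !tits_preim_m iotaK.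
Qed.

Definition tits_inv (v : model) : jordanC R :=
  sval (cid (tits_surj v.1.1 v.1.2 v.2)).

Lemma tits_invK : cancel tits_inv tits.
Proof. by case=> [[A B] D]; rewrite /tits_inv /=; case: cid. Qed.

Lemma titsK : cancel tits tits_inv.
Proof. by move=> X; apply: tits_inj; rewrite tits_invK. Qed.

Lemma tits_linear : linear tits.
Proof.
by move=> a X Y; rewrite /tits titsA_linear titsB_linear titsC_linear.
Qed.

Lemma tits_inv_linear : linear tits_inv.
Proof.
by move=> a v w; apply: tits_inj; rewrite tits_linear !tits_invK.
Qed.

Lemma tits_w (X : jordanC R) :
  tits (wC X) = (titsA X, omega1 R ^+ 2 *: titsB X, omega1 R *: titsC X).
Proof. by rewrite /tits titsA_w titsB_w titsC_w. Qed.

(** * Determinant and Hermitian form in Tits coordinates *)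

Lemma formC_tits (X Y : jordanC R) :
  Defs.formC X Y = \tr (titsA X *m titsA Y) + \tr (titsB X *m titsC Y)
            + \tr (titsC X *m titsB Y).
Proof.
case: X Y => [X1 X2] [Y1 Y2].
rewrite /Defs.formC /cplx_form !jordan_formE /form_entry /=.
rewrite /mxtrace !sum3 !mxE !sum3 !mxE /=.
have [? [? [? [? [? [? EX1]]]]]] := jordan_entries X1.
have [? [? [? [? [? [? EX2]]]]]] := jordan_entries X2.
have [? [? [? [? [? [? EY1]]]]]] := jordan_entries Y1.
have [? [? [? [? [? [? EY2]]]]]] := jordan_entries Y2.
rewrite /ord3S /= !EX1 !EX2 !EY1 !EY2 /cay_m /=.
apply/eqP; rewrite eq_complex; apply/andP; split; apply/eqP;
  rewrite /cay_dot /cay_a /cay_m1 /cay_m2 /cay_m3 /cay_re /=.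
  by ring.
by ring.
Qed.

Lemma subM_entry (M N P : 'M[C]_3) i j : (M - N *m P) i j =
  M i j - (N i o0 * P o0 j + N i o1 * P o1 j + N i o2 * P o2 j).
Proof. by rewrite !mxE sum3. Qed.

(** Each entry of the formulas below is a polynomial identity between the real
    coordinates of X, once real and imaginary parts are separated. *)
Ltac cross_entries EX1 EX2 :=
  apply/matrixP; elim/ord3P; elim/ord3P;
  rewrite subM_entry adj3E !(titsAE, titsBE, titsCE) crossC1E crossC2E;
  rewrite /cross_entry /mul_entry /form_entry /tr_entry;
  rewrite /ord3S /= !EX1 !EX2 /cay_m /=;
  apply/eqP; rewrite eq_complex; apply/andP; split; apply/eqP;
  rewrite /cay_dot /cay_a /cay_m1 /cay_m2 /cay_m3 /cay_re /=;
  field.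

Lemma tits_crossA (X : jordanC R) :
  titsA (crossC X X) = \adj (titsA X) - titsB X *m titsC X.
Proof.
have [? [? [? [? [? [? EX1]]]]]] := jordan_entries X.1.
have [? [? [? [? [? [? EX2]]]]]] := jordan_entries X.2.
by cross_entries EX1 EX2.
Qed.

Lemma tits_crossB (X : jordanC R) :
  titsB (crossC X X) = \adj (titsC X) - titsA X *m titsB X.
Proof.
have [? [? [? [? [? [? EX1]]]]]] := jordan_entries X.1.
have [? [? [? [? [? [? EX2]]]]]] := jordan_entries X.2.
by cross_entries EX1 EX2.
Qed.

Lemma tits_crossC (X : jordanC R) :
  titsC (crossC X X) = \adj (titsB X) - titsC X *m titsA X.
Proof.
have [? [? [? [? [? [? EX1]]]]]] := jordan_entries X.1.
have [? [? [? [? [? [? EX2]]]]]] := jordan_entries X.2.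
by cross_entries EX1 EX2.
Qed.

(** Multiplying by A, B, D turns the components of X x X into the terms of the
    formula, since A adj A = det A; the three mixed terms are equal because the
    trace is cyclic. *)
Lemma detC_tits (X : jordanC R) :
  detC X = \det (titsA X) + \det (titsB X) + \det (titsC X)
           - \tr (titsA X *m titsB X *m titsC X).
Proof.
have adjtr (M : 'M[C]_3) : \tr (M *m \adj M) = 3 * \det M.
  by rewrite mul_mx_adj mxtrace_scalar mulr_natl.
rewrite /detC formC_tits tits_crossA tits_crossB tits_crossC.
move: (titsA X) (titsB X) (titsC X) => A B D.
have tr_mul_cross (M N P : 'M[C]_3) :
    \tr (M *m (\adj M - N *m P)) = 3 * \det M - \tr (M *m N *m P).
  by rewrite mulmxBr linearB /= adjtr mulmxA.
rewrite !tr_mul_cross (mxtrace_mulC (B *m D)) -(mulmxA D) (mxtrace_mulC D) mulmxA.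
by field.
Qed.

Lemma conj_iota (z w : C) :
  Num.conj (z + 'i%C * w) = (z^*)%C - 'i%C * (w^*)%C.
Proof.
rewrite -[LHS]/((z + 'i%C * w)^*)%C; case: z w => [? ?] [? ?].
by apply: complex_eqP => /=; ring.
Qed.

Lemma cay_a_conj (x : cayley R) : cay_a (cay_conj x) = ((cay_a x)^*)%C.
Proof. by []. Qed.

Lemma cay_aN (x : cayley R) : cay_a (- x) = - cay_a x.
Proof. by []. Qed.

Lemma cay_mN k (x : cayley R) : cay_m k (- x) = - cay_m k x.
Proof.
by elim/ord3P: k; apply: complex_eqP => //=; rewrite /cay_m /= ?opprK.
Qed.

Lemma jordanN_entry (Z : jordan R) j k : (- Z) j k = - Z j k.
Proof. by rewrite mxE. Qed.

Lemma conjcN (z : C) : ((- z)^*)%C = - (z^*)%C.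
Proof. by case: z => ? ?; apply: complex_eqP. Qed.

(** As tau replaces i by -i, it exchanges the two identifications of e1 up to
    complex conjugation; hence it exchanges [titsB] and [titsC]. *)
Lemma titsA_tau (X : jordanC R) : titsA (tau X) = (titsA X) ^t*.
Proof.
apply/matrixP=> j k; rewrite [RHS]mxE [in RHS]mxE !titsAE conj_iota.
rewrite -!cay_a_conj -!jordan_conj [(tau X).1 _ _]/(X.1 j k).
by rewrite [(tau X).2 j k]jordanN_entry cay_aN mulrN.
Qed.

Lemma titsB_tau (X : jordanC R) : titsB (tau X) = (titsC X) ^t*.
Proof.
apply/matrixP=> l k; rewrite [RHS]mxE [in RHS]mxE titsBE titsCE conj_iota.
by rewrite [(tau X).2 _ _]jordanN_entry cay_mN conjcN mulrN.
Qed.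

Lemma titsC_tau (X : jordanC R) : titsC (tau X) = (titsB X) ^t*.
Proof.
apply/matrixP=> k l; rewrite [RHS]mxE [in RHS]mxE titsBE titsCE conj_iota.
by rewrite !conjcK [(tau X).2 _ _]jordanN_entry cay_mN mulrN.
Qed.

Lemma hprodC_tits (X Y : jordanC R) : hprodC X Y =
  \tr ((titsA X) ^t* *m titsA Y) + \tr ((titsB X) ^t* *m titsB Y)
  + \tr ((titsC X) ^t* *m titsC Y).
Proof.
rewrite /hprodC formC_tits titsA_tau titsB_tau titsC_tau; exact: addrAC.
Qed.

(** * The action of SU(3) x SU(3) x SU(3) *)

Definition su3_act (g : SU3 R * SU3 R * SU3 R) (v : model) : model :=
  (g.1.1 *m v.1.1 *m g.1.2 ^t*, g.1.2 *m v.1.2 *m g.2 ^t*, g.2 *m v.2 *m g.1.1 ^t*).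

Lemma su3_act_linear g : linear (su3_act g).
Proof.
move=> a v w; rewrite /su3_act /=.
by congr (_, _, _); rewrite mulmxDr mulmxDl -scalemxAr -scalemxAl.
Qed.

Lemma su3_actM g h v : su3_act (g * h)%g v = su3_act g (su3_act h v).
Proof.
have -> : su3_act (g * h)%g v =
    (g.1.1 *m h.1.1 *m v.1.1 *m (g.1.2 *m h.1.2) ^t*,
     g.1.2 *m h.1.2 *m v.1.2 *m (g.2 *m h.2) ^t*,
     g.2 *m h.2 *m v.2 *m (g.1.1 *m h.1.1) ^t*) by [].
by rewrite /su3_act /= !adjmx_mul !mulmxA.
Qed.

Lemma su3_act1 v : su3_act 1%g v = v.
Proof.
case: v => [[A B] D].
have -> : su3_act 1%g (A, B, D) =
    (1%:M *m A *m 1%:M ^t*, 1%:M *m B *m 1%:M ^t*, 1%:M *m D *m 1%:M ^t*) by [].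
by rewrite /= trmx1 map_mx1 !mul1mx !mulmx1.
Qed.

Definition rho_fun g (X : jordanC R) : jordanC R := tits_inv (su3_act g (tits X)).

Lemma tits_rho g X : tits (rho_fun g X) = su3_act g (tits X).
Proof. exact: tits_invK. Qed.

Lemma titsA_rho g X : titsA (rho_fun g X) = g.1.1 *m titsA X *m g.1.2 ^t*.
Proof. by have [] := tits_rho g X. Qed.

Lemma titsB_rho g X : titsB (rho_fun g X) = g.1.2 *m titsB X *m g.2 ^t*.
Proof. by have [] := tits_rho g X. Qed.

Lemma titsC_rho g X : titsC (rho_fun g X) = g.2 *m titsC X *m g.1.1 ^t*.
Proof. by have [] := tits_rho g X. Qed.

Lemma rho_funM g h X : rho_fun (g * h)%g X = rho_fun g (rho_fun h X).
Proof. by apply: tits_inj; rewrite !tits_rho su3_actM. Qed.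

Lemma rho_fun1 X : rho_fun 1%g X = X.
Proof. by apply: tits_inj; rewrite tits_rho su3_act1. Qed.

Fact rho_aut_subproof g : `[< linear (rho_fun g) /\ bijective (rho_fun g) >].
Proof.
apply/asboolP; split.
  by move=> a X Y; rewrite /rho_fun tits_linear su3_act_linear tits_inv_linear.
by exists (rho_fun g^-1%g) => X; rewrite -rho_funM ?mulVg ?mulgV rho_fun1.
Qed.
Definition rho_aut g : @linear_aut R[i] (jordanC R) := LinearAut (rho_aut_subproof g).

Lemma det_su3_conj (P Q : SU3 R) (A : M3) : \det (P *m A *m Q ^t*) = \det A.
Proof. by rewrite !det_mulmx det_adjmx !SU3_det rmorph1 mul1r mulr1. Qed.

Lemma mxtrace_su3_conj (P Q : SU3 R) (A B : M3) :
  \tr ((P *m A *m Q ^t*) ^t* *m (P *m B *m Q ^t*)) = \tr (A ^t* *m B).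
Proof.
rewrite !adjmx_mul trmxCK -!mulmxA mxtrace_mulC -!mulmxA SU3_mulVmx mulmx1.
by rewrite (mulmxA (P ^t*)) SU3_mulVmx mul1mx.
Qed.

Lemma mxtrace_su3_cycle (P Q T : SU3 R) (A B D : M3) :
  \tr (P *m A *m Q ^t* *m (Q *m B *m T ^t*) *m (T *m D *m P ^t*)) = \tr (A *m B *m D).
Proof.
have cancel_SU3 (X : M3) (S : SU3 R) : X *m S ^t* *m S = X.
  by rewrite -mulmxA SU3_mulVmx mulmx1.
by rewrite !mulmxA !cancel_SU3 mxtrace_mulC !mulmxA SU3_mulVmx mul1mx.
Qed.

Fact rho_E6_subproof g : E6_pred (rho_aut g).
Proof.
apply/asboolP; split=> [X|X Y].
  have -> : rho_aut g X = rho_fun g X by [].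
  rewrite 2!detC_tits titsA_rho titsB_rho titsC_rho !det_su3_conj.
  by rewrite mxtrace_su3_cycle.
have [-> ->] : rho_aut g X = rho_fun g X /\ rho_aut g Y = rho_fun g Y by [].
rewrite (hprodC_tits (rho_fun g X)) (hprodC_tits X) !titsA_rho !titsB_rho !titsC_rho.
by rewrite !mxtrace_su3_conj.
Qed.

Definition rho_E6 g : E6 R := MkE6 (rho_E6_subproof g).

Fact rho_E6w_subproof g : E6w_pred (rho_E6 g).
Proof.
apply/asboolP/funext => X; apply: tits_inj => /=.
rewrite tits_w tits_rho tits_w titsA_rho titsB_rho titsC_rho.
by rewrite /su3_act /= -!scalemxAr -!scalemxAl.
Qed.
Definition rho g : E6w R := MkE6w (rho_E6w_subproof g).

Lemma rhoE g X : rho g X = rho_fun g X.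
Proof. by []. Qed.

Lemma rhoM : {morph rho : g h / (g * h)%g}.
Proof. by move=> g h; do 3!apply: val_inj; apply/funext => X; apply: rho_funM. Qed.

HB.instance Definition _ := isMultiplicative.Build _ _ rho rhoM.

(** * The kernel of the action *)

Lemma omega1_neq1 : omega1 R != 1.
Proof.
rewrite eq_complex /= negb_and; apply/orP; right.
by rewrite mulf_neq0 ?invr_eq0 ?pnatr_eq0 // gt_eqF // sqrtr_gt0 ltr0n.
Qed.

Lemma omega1_sum : 1 + omega1 R + omega1 R ^+ 2 = 0.
Proof.
have /eqP : (omega1 R - 1) * (1 + omega1 R + omega1 R ^+ 2) = 0.
  transitivity (omega1 R ^+ 3 - 1); first by ring.
  by rewrite omega1_cube subrr.
by rewrite mulf_eq0 subr_eq0 (negPf omega1_neq1) => /eqP.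
Qed.

Lemma cube_root_unity (c : C) : c ^+ 3 = 1 -> exists k, c = omega1 R ^+ k.
Proof.
move=> c3; pose w := omega1 R.
have /eqP : (c - 1) * (c - w) * (c - w ^+ 2) = 0.
  transitivity (c ^+ 3 - (1 + w + w ^+ 2) * c ^+ 2
      + w * (1 + w + w ^+ 2) * c - w ^+ 3); first by ring.
  by rewrite omega1_sum c3 omega1_cube; ring.
rewrite !mulf_eq0 !subr_eq0 => /orP [/orP [] |] /eqP ->.
- by exists 0%N.
- by exists 1%N.
by exists 2%N.
Qed.

Lemma Z3_ker g : rho g = 1%g <-> g \in nsub_pred (Z3 R).
Proof.
have -> : rho g = 1%g <-> forall v, su3_act g v = v.
  split=> [g1 v|act1].
    rewrite -[v in LHS]tits_invK -tits_rho -rhoE g1.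
    by rewrite -[RHS]tits_invK.
  do 3!apply: val_inj; apply/funext => X.
  by apply: tits_inj; rewrite tits_rho act1.
split=> [act1|/Z3_predP [k [g1 g2 g3]] v]; last first.
  pose a := omega1 R ^+ k.
  have aJ : Num.conj a * a = 1.
    by rewrite rmorphXn /= omega1_conj -exprMn -exprSr omega1_cube expr1n.
  case: v => [[A B] D]; rewrite /su3_act /= g1 g2 g3 tr_scalar_mx map_scalar_mx.
  by rewrite !mul_scalar_mx !mul_mx_scalar !scalerA aJ !scale1r.
have EA A : g.1.1 *m A = A *m g.1.2.
  have [E _ _] := act1 (A, 0, 0).
  by rewrite -[in RHS]E /= -!mulmxA SU3_mulVmx mulmx1.
have EB A : g.1.2 *m A = A *m g.2.
  have [_ E _] := act1 (0, A, 0).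
  by rewrite -[in RHS]E /= -!mulmxA SU3_mulVmx mulmx1.
have E12 : SU3_mx g.1.1 = g.1.2 by rewrite -[LHS]mulmx1 EA mul1mx.
have E23 : SU3_mx g.1.2 = g.2 by rewrite -[LHS]mulmx1 EB mul1mx.
have [|c Ec] := @central_mx_scalar _ _ (SU3_mx g.1.1).
  by move=> A; rewrite EA E12.
have c3 : c ^+ 3 = 1 by rewrite -det_scalar -Ec SU3_det.
have [k ck] := cube_root_unity c3.
by apply/Z3_predP; exists k; rewrite /= -E23 -E12 Ec ck.
Qed.

(** * Surjectivity of the action *)

Lemma scaler_neq_eq0 (V : lmodType C) (a b : C) (v : V) :
  a != b -> a *: v = b *: v -> v = 0.
Proof.
move=> ab /eqP; rewrite -subr_eq0 -scalerBl scaler_eq0 subr_eq0 (negPf ab) /=.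
by move/eqP.
Qed.

Lemma omega1_sqr_neq1 : omega1 R ^+ 2 != 1.
Proof.
apply: contra_neq omega1_neq1 => w2.
by rewrite -[LHS]mulr1 -w2 -exprS omega1_cube.
Qed.

Lemma omega1_sqr_neq : omega1 R ^+ 2 != omega1 R.
Proof.
apply: contra_neq omega1_neq1 => w2.
by rewrite -(omega1_cube R) exprS w2 -expr2 w2.
Qed.

Section Surjectivity.
Variable alpha : E6w R.

Let alpha_lin : linear (alpha : jordanC R -> jordanC R).
Proof. exact: linear_aut_linear. Qed.

Let alpha_det X : detC (alpha X) = detC X.
Proof. by have /asboolP [] := E6P alpha. Qed.

Let alpha_hprod X Y : hprodC (alpha X) (alpha Y) = hprodC X Y.
Proof. by have /asboolP [] := E6P alpha. Qed.

Let alpha_w X : wC (alpha X) = alpha (wC X).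
Proof. by have /asboolP e := E6wP alpha; rewrite -[LHS]/((@wC R \o alpha) X) e. Qed.

(** That alpha has no further blocks is shown by [mA], [mB] and [mD]. *)
Let f A := titsA (alpha (tits_inv (A, 0, 0))).
Let g B := titsB (alpha (tits_inv (0, B, 0))).
Let h D := titsC (alpha (tits_inv (0, 0, D))).

Let m : model -> model := fun v => tits (alpha (tits_inv v)).

Let m_lin : linear m.
Proof. by move=> a v w; rewrite /m tits_inv_linear alpha_lin tits_linear. Qed.

Let mZ a v : m (a *: v) = a *: m v.
Proof.
have m0 : m 0 = 0 by have := m_lin (-1) 0 0; rewrite scaleN1r addNr scaleN1r addNr.
by have := m_lin a v 0; rewrite addr0 m0 addr0.
Qed.

Let w_model (v : model) : model := (v.1.1, omega1 R ^+ 2 *: v.1.2, omega1 R *: v.2).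

Let m_w v : w_model (m v) = m (w_model v).
Proof.
have -> : w_model (m v) = tits (wC (alpha (tits_inv v))) by rewrite tits_w.
rewrite alpha_w; congr (tits (alpha _)); apply: tits_inj.
by rewrite tits_w [RHS]tits_invK -[v in RHS]tits_invK.
Qed.

(** In the next three lemmas the eigenvalues 1, omega1^2 and omega1 of w on the
    summands are distinct, so alpha, commuting with w, is block diagonal. *)
Let mA A : m (A, 0, 0) = (f A, 0, 0).
Proof.
have := m_w (A, 0, 0).
have -> : w_model (A, 0, 0) = (A, 0, 0) by rewrite /w_model /= !scaler0.
case E : (m (A, 0, 0)) => [[A' B] D].
move/(congr1 (fun v : model => (v.1.2, v.2))) => /= [EB ED].
have -> : f A = A' by rewrite -[f A]/((m (A, 0, 0)).1.1) E.
rewrite (scaler_neq_eq0 omega1_sqr_neq1 (etrans EB (esym (scale1r _)))).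
by rewrite (scaler_neq_eq0 omega1_neq1 (etrans ED (esym (scale1r _)))).
Qed.

Let mB B : m (0, B, 0) = (0, g B, 0).
Proof.
have := m_w (0, B, 0).
have -> : w_model (0, B, 0) = omega1 R ^+ 2 *: ((0, B, 0) : model).
  by rewrite -[RHS]/(_ *: 0, _ *: B, _ *: 0) /w_model /= !scaler0.
rewrite mZ; case E : (m (0, B, 0)) => [[A B'] D].
move/(congr1 (fun v : model => (v.1.1, v.2))) => /= [EA ED].
have -> : g B = B' by rewrite -[g B]/((m (0, B, 0)).1.2) E.
rewrite (scaler_neq_eq0 omega1_sqr_neq1 (etrans (esym EA) (esym (scale1r _)))).
by rewrite (scaler_neq_eq0 omega1_sqr_neq (esym ED)).
Qed.

Let mD D : m (0, 0, D) = (0, 0, h D).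
Proof.
have := m_w (0, 0, D).
have -> : w_model (0, 0, D) = omega1 R *: ((0, 0, D) : model).
  by rewrite -[RHS]/(_ *: 0, _ *: 0, _ *: D) /w_model /= !scaler0.
rewrite mZ; case E : (m (0, 0, D)) => [[A B] D'].
move/(congr1 (fun v : model => (v.1.1, v.1.2))) => /= [EA EB].
have -> : h D = D' by rewrite -[h D]/((m (0, 0, D)).2) E.
rewrite (scaler_neq_eq0 omega1_neq1 (etrans (esym EA) (esym (scale1r _)))).
by rewrite (scaler_neq_eq0 omega1_sqr_neq EB).
Qed.

Let mE A B D : m (A, B, D) = (f A, g B, h D).
Proof.
have -> : (A, B, D) = 1 *: (A, 0, 0) + (1 *: (0, B, 0) + (0, 0, D)) :> model.
  by rewrite !scale1r; congr (_, _, _); rewrite /= ?addr0 ?add0r.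
rewrite !m_lin mA mB mD !scale1r.
by congr (_, _, _); rewrite /= ?addr0 ?add0r.
Qed.

Let model_det (v : model) : C :=
  \det v.1.1 + \det v.1.2 + \det v.2 - \tr (v.1.1 *m v.1.2 *m v.2).

Let m_det v : model_det (m v) = model_det v.
Proof.
rewrite -[v in RHS]tits_invK -[LHS]/(model_det (tits _)).
by rewrite /model_det -!detC_tits alpha_det.
Qed.

Let model_hprod (u v : model) : C :=
  \tr (u.1.1 ^t* *m v.1.1) + \tr (u.1.2 ^t* *m v.1.2) + \tr (u.2 ^t* *m v.2).

Let m_hprod u v : model_hprod (m u) (m v) = model_hprod u v.
Proof.
rewrite -[u in RHS]tits_invK -[v in RHS]tits_invK.
by rewrite /model_hprod -!hprodC_tits alpha_hprod.
Qed.

Let h_lin : linear h.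
Proof.
move=> a X Y; have := m_lin a (0, 0, X) (0, 0, Y).
have -> : a *: (0, 0, X) + (0, 0, Y) = (0, 0, a *: X + Y) :> model.
  by rewrite -[LHS]/(a *: 0 + 0, a *: 0 + 0, a *: X + Y) scaler0 addr0.
by rewrite !mD => /(congr1 snd).
Qed.

Lemma rho_surj : exists g, rho g = alpha.
Proof.
pose hL : {linear M3 -> M3} := HB.pack h (GRing.isLinear.Build _ _ _ _ h h_lin).
have det00 : \det (0 : M3) = 0 by rewrite det0.
have fdet A : \det (f A) = \det A.
  have := m_det (A, 0, 0); rewrite mA /model_det /= det00 !mulmx0 !mxtrace0.
  by rewrite !addr0 !subr0.
have gdet A : \det (g A) = \det A.
  have := m_det (0, A, 0); rewrite mB /model_det /= det00 !mulmx0 !mxtrace0.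
  by rewrite !addr0 !add0r !subr0.
have hdet A : \det (h A) = \det A.
  have := m_det (0, 0, A); rewrite mD /model_det /= det00 mulmx0 !mul0mx !mxtrace0.
  by rewrite !add0r !subr0.
have ftr A B D : \tr (f A *m g B *m h D) = \tr (A *m B *m D).
  have := m_det (A, B, D); rewrite mE /model_det /= fdet gdet hdet.
  by move/addrI/oppr_inj.
have fiso A B : \tr ((f A) ^t* *m f B) = \tr (A ^t* *m B).
  have := m_hprod (A, 0, 0) (B, 0, 0); rewrite !mA /model_hprod /= !mulmx0 !mxtrace0.
  by rewrite !addr0.
have giso A B : \tr ((g A) ^t* *m g B) = \tr (A ^t* *m B).
  have := m_hprod (0, A, 0) (0, B, 0); rewrite !mB /model_hprod /= !mulmx0 !mxtrace0.
  by rewrite !addr0 !add0r.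
have hiso A B : \tr ((h A) ^t* *m h B) = \tr (A ^t* *m B).
  have := m_hprod (0, 0, A) (0, 0, B); rewrite !mD /model_hprod /= !mulmx0 !mxtrace0.
  by rewrite !add0r.
have hsurj Z : exists D, hL D = Z.
  have [beta _ betaK] := linear_aut_bij alpha.
  pose X := tits (beta (tits_inv (0, 0, Z))).
  have mX : m X = (0, 0, Z) by rewrite /m /X titsK betaK tits_invK.
  by exists X.2; move: mX; rewrite mE => - [].
have [P [Q [T [[PP QQ TT] [dP dQ dT] fE gE hE]]]] :=
  @trilinear_isometries _ _ f g hL hsurj ftr fiso giso hiso fdet gdet.
have SU (S : M3) : S ^t* *m S = 1%:M -> \det S = 1 ->
    (S ^t* *m S == 1%:M) && (\det S == 1) by move=> -> ->; rewrite !eqxx.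
exists (MkSU3 (SU P PP dP), MkSU3 (SU Q QQ dQ), MkSU3 (SU T TT dT)).
do 3!apply: val_inj; apply/funext => X; apply: tits_inj.
rewrite tits_rho -[X in RHS]titsK -[RHS]/(m (tits X)) mE fE gE.
by rewrite -[h _]/(hL _) hE.
Qed.

End Surjectivity.

End TitsConstruction.

Theorem theorem3p13p5 (R : realType) :
  group_isomorphic (E6w R)
    (@quotient_group (SU3 R * SU3 R * SU3 R)%type (Z3 R)).
Proof. exact: quotient_isomorphic (@rho_surj R) (@Z3_ker R). Qed.
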